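(* Let $f\in\mathcal G$ be reversible in $\mathcal G$. Then $f$ is reversible in $\mathcal G$ by a finite order element $h\in\mathcal G$ which is, moreover, either an involution or of order a multiple of $4$.
   Context: An interval exchange transformation (IET) is a bijection of $[0,1)$ defined by a finite partition of $[0,1)$ into half-open subintervals and a reordering of these intervals by translations; $\mathcal G$ is the group of all IETs. $f\in\mathcal G$ is reversible in $\mathcal G$ if there is $h\in\mathcal G$ with $hfh^{-1}=f^{-1}$; one then says $f$ is reversible by $h$. An involution is an element whose square is the identity. *)

(* Defs.v *)
From HB Require Import structures.
From mathcomp Require Import all_boot all_order all_algebra.
From mathcomp Require Import lra boolp reals numfun.

Set Implicit Arguments.
Unset Strict Implicit.
Unset Printing Implicit Defensive.

Import Order.TTheory GRing.Theory Num.Theory.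

Local Open Scope ring_scope.

Definition unit_itv (R : realType) := {x : R | 0 <= x < 1}.

(* [itv_partition 0 1 s] means that 0 :: s is strictly increasing with last
   term 1; its pieces are [0, s_0), [s_0, s_1), ..., [s_(k-2), 1) for k the
   size of s. As f is bijective, the translated pieces again partition
   [0, 1), i.e. f reorders them. *)
Definition is_iet (R : realType) (f : unit_itv R -> unit_itv R) : Prop :=
  bijective f /\
  exists2 s : seq R, itv_partition 0 1 s &
    forall i, (i < size s)%N -> exists t : R,
      forall x : unit_itv R,
        nth 0 (0 :: s) i <= val x < nth 0 s i -> val (f x) = val x + t.

Section closure.
Context {R : realType}.
Local Notation I := (unit_itv R).
Implicit Types (f g : I -> I) (x y u v : I).

(* f is a translation on [x, y] as soon as no point of s lies in (x, y]; unlike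
   an [itv_partition], s need not be sorted, nor contained in [0, 1]. *)
Definition breaks f (s : seq R) := forall x y, val x <= val y ->
  (forall p, p \in s -> ~~ (val x < p <= val y)) ->
  val (f y) = val (f x) + (val y - val x).

Lemma sub_uitvP (a : R) : 0 <= a < 1 -> exists x : I, val x = a.
Proof. by move=> h; exists (exist _ a h). Qed.

Lemma partition_piece (s : seq R) (a b r : R) : itv_partition a b s -> a <= r < b ->
  exists2 i, (i < size s)%N & nth 0 (a :: s) i <= r < nth 0 s i.
Proof.
elim: s a => [|c s ih] a [] /=.
  by move=> _ /eqP -> /andP[h1 h2]; have := le_lt_trans h1 h2; rewrite ltxx.
move=> /andP[ac cs] lb /andP[ar rb]; case: (ltP r c) => rc.
  by exists 0%N => //=; rewrite ar.
have [i is_ hi] := ih c (conj cs lb) (introT andP (conj rc rb)).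
by exists i.+1.
Qed.

Lemma iet_breaks f : is_iet f -> exists s, breaks f s.
Proof.
move=> [_ [s sp fs]]; exists (0 :: s) => x y xy nb.
have [i si /andP[iy yi]] := partition_piece sp (valP y).
have ix : nth 0 (0 :: s) i <= val x.
  rewrite leNgt; apply/negP => hx.
  have := nb (nth 0 (0 :: s) i) (mem_nth _ _); rewrite hx iy /=.
  by move=> /(_ (ltnW si)).
have [t ft] := fs i si.
rewrite (ft x) ?ix ?(le_lt_trans xy yi)// (ft y) ?iy ?yi//.
lra.
Qed.

Lemma path_no_between (s : seq R) (a p : R) i : path <%R a s ->
  (i < size s)%N -> p \in a :: s -> ~~ (nth 0 (a :: s) i < p < nth 0 s i).
Proof.
move=> ps si /(nthP 0)[j]; rewrite /= ltnS => js <-.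
have srt : sorted <%R (a :: s) by [].
have mono := lt_sorted_ltn_nth 0 srt.
rewrite -[nth 0 s i]/(nth 0 (a :: s) i.+1); apply/negP => /andP[].
rewrite !mono ?inE /= ?ltnS// ?(ltnW si)//.
by move=> ij ji; have := leq_trans ij ji; rewrite ltnn.
Qed.

Lemma breaks_iet f s : bijective f -> breaks f s -> is_iet f.
Proof.
move=> bf fs; split=> //.
pose w := sort <=%R (undup [seq p <- s | 0 < p < 1]).
have memw p : p \in w = (p \in s) && (0 < p < 1).
  by rewrite mem_sort mem_undup mem_filter andbC.
have sw : sorted <%R w.
  by rewrite lt_sorted_uniq_le sort_uniq undup_uniq sort_le_sorted.
have pw : path <%R 0 (rcons w 1).
  rewrite rcons_path; apply/andP; split.
    rewrite path_sortedE; last exact: lt_trans.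
    rewrite sw andbT; apply/allP => p; rewrite memw => /andP[_].
    by case/andP.
  have := mem_last 0 w; rewrite inE => /orP[/eqP ->|]; first exact: ltr01.
  by rewrite memw => /andP[_ /andP[]].
exists (rcons w 1); first by split=> //; rewrite last_rcons.
move=> i si; set a := nth 0 _ i; set b := nth 0 _ i.
have a0 : 0 <= a.
  have : a \in 0 :: rcons w 1 by apply: mem_nth; rewrite /= ltnW.
  rewrite inE => /orP[/eqP -> //|]; rewrite mem_rcons inE => /orP[/eqP ->//|].
  by rewrite memw => /andP[_ /andP[/ltW]].
have b1 : b <= 1.
  have : b \in rcons w 1 by apply: mem_nth.
  rewrite mem_rcons inE => /orP[/eqP ->//|].
  by rewrite memw => /andP[_ /andP[_ /ltW]].
have [ba|ab] := leP b a.
  by exists 0 => x /andP[h1 h2]; have := le_lt_trans (le_trans ba h1) h2; rewrite ltxx.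
have [c ca] : exists c : I, val c = a.
  by apply: sub_uitvP; rewrite a0 (lt_le_trans ab b1).
exists (val (f c) - val c) => x; rewrite -ca => /andP[cx xb].
rewrite (fs c x cx) 1?addrCA // => p ps; apply/negP => /andP[cp px].
have pw' : p \in 0 :: rcons w 1.
  rewrite inE mem_rcons inE memw ps /=.
  rewrite (le_lt_trans px)/= ?(lt_le_trans xb b1)//.
  by rewrite (le_lt_trans _ cp) ?ca// !orbT.
have := path_no_between pw si pw'.
by rewrite -/a -/b -ca cp (le_lt_trans px xb).
Qed.

Lemma is_iet_id : is_iet (@id I).
Proof.
apply: (@breaks_iet _ [::]); first by exists id.
by move=> x y xy _; rewrite addrC subrK.
Qed.

Lemma is_iet_comp f g : is_iet f -> is_iet g -> is_iet (f \o g).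
Proof.
move=> fi gi; have [s fs] := iet_breaks fi; have [t gt] := iet_breaks gi.
have [g' gK g'K] := proj1 gi.
apply: (@breaks_iet _ (t ++ [seq oapp (val \o g') 0 (insub p) | p <- s])).
  by apply: bij_comp; [case: fi | case: gi].
move=> x y xy nb.
have gz z : val x <= val z -> val z <= val y ->
    val (g z) = val (g x) + (val z - val x).
  move=> xz zy; apply: gt => // p pt; have := nb p.
  rewrite mem_cat pt => /(_ isT); apply: contra => /andP[-> /=].
  by move=> /le_trans; exact.
have gy := gz y xy (lexx _).
have gxy : val (g x) <= val (g y) by rewrite gy lerDl subr_ge0.
rewrite /= (fs _ _ gxy); first by rewrite gy [val (g x) + _]addrC addrK.
move=> p ps; apply/negP => /andP[xp py].
have p01 : 0 <= p < 1.
  have /andP[h0 _] := valP (g x); have /andP[_ h1] := valP (g y).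
  by rewrite (le_trans h0 (ltW xp)) (le_lt_trans py h1).
have zxy : val x < val x + (p - val (g x)) <= val y.
  rewrite ltrDl subr_gt0 xp /= -lerBrDl lerBlDl.
  by rewrite gy in py.
have [z zE] : exists z : I, val z = val x + (p - val (g x)).
  apply: sub_uitvP; case/andP: zxy => h1 h2.
  have /andP[h0 _] := valP x; have /andP[_ h3] := valP y.
  by rewrite (le_trans h0 (ltW h1)) (le_lt_trans h2 h3).
have gzp : val (g z) = p.
  case/andP: zxy => h1 h2; rewrite gz ?zE ?(ltW h1)//.
  by rewrite [val x + _]addrC addrK addrC subrK.
have := nb (val z); rewrite zE zxy => /(_ _)/negP; apply => //.
rewrite -zE mem_cat; apply/orP; right; apply/mapP; exists p => //.
by rewrite -gzp valK /= gK.
Qed.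

Lemma is_iet_inv f g : cancel f g -> cancel g f -> is_iet f -> is_iet g.
Proof.
move=> fK gK [_ [s sp fs]].
apply: (@breaks_iet _ [seq oapp (val \o f) 0 (insub p) | p <- 0 :: s]).
  by exists f.
move=> u v uv nb.
have [i si /andP[iy yi]] := partition_piece sp (valP (g v)).
have [t ft] := fs i si.
set a := nth 0 (0 :: s) i in iy ft.
have a0 : 0 <= a.
  rewrite /a; case: (i) si => [|j] //= js.
  have := order_path_min lt_trans (proj1 sp) => /allP/(_ _ (mem_nth 0 (ltnW js))).
  exact: ltW.
have a01 : 0 <= a < 1.
  by rewrite a0 (le_lt_trans iy)//; have /andP[] := valP (g v).
have [c ca] := sub_uitvP a01.
have fc : val (f c) = a + t by rewrite ft ca ?lexx ?(le_lt_trans iy yi).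
have fgv : val v = val (g v) + t by rewrite -ft ?gK ?iy.
have cu : val (f c) <= val u.
  rewrite leNgt; apply/negP => uc.
  have := nb (val (f c)); rewrite uc andTb fc fgv lerD2r iy => /(_ _)/negP; apply => //.
  apply/mapP; exists a; first by apply: mem_nth; rewrite /= ltnW.
  by rewrite -fc -ca valK.
have zle : a <= val u - t <= val (g v).
  by rewrite lerBrDr -fc cu lerBlDr -fgv.
have [z zE] : exists z : I, val z = val u - t.
  apply: sub_uitvP; case/andP: zle => h1 h2.
  by rewrite (le_trans a0 h1) (le_lt_trans h2)//; have /andP[] := valP (g v).
have fz : f z = u.
  apply: val_inj; rewrite ft zE ?subrK//.
  by case/andP: zle => -> /le_lt_trans ->.
by rewrite -fz fK zE fz fgv; lra.
Qed.

End closure.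

Definition IET (R : realType) : Type :=
  {f : unit_itv R -> unit_itv R | `[< is_iet f >]}.

HB.instance Definition _ (R : realType) := SubType.on (IET R).
HB.instance Definition _ (R : realType) := [Choice of IET R by <:].

Section group.
Context {R : realType}.
Local Notation G := (IET R).
Implicit Types f g h : G.

Lemma ietP f : is_iet (val f).
Proof. by case: f => f0 hf; apply/asboolP. Qed.

Definition mk_iet (f : unit_itv R -> unit_itv R) (hf : is_iet f) : G :=
  exist _ f (introT (asboolP _) hf).

Lemma iet_has_inv f : exists k : unit_itv R -> unit_itv R,
  cancel (val f) k /\ cancel k (val f).
Proof. by have [[g gK Kg] _] := ietP f; exists g. Qed.

Definition iet_inv_fun f := sval (cid (iet_has_inv f)).

Lemma iet_funK f : cancel (val f) (iet_inv_fun f).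
Proof. exact: (proj1 (svalP (cid (iet_has_inv f)))). Qed.

Lemma iet_inv_funK f : cancel (iet_inv_fun f) (val f).
Proof. exact: (proj2 (svalP (cid (iet_has_inv f)))). Qed.

Definition iet_one : G := mk_iet is_iet_id.
Definition iet_mul f g : G := mk_iet (is_iet_comp (ietP f) (ietP g)).
Definition iet_inv f : G :=
  mk_iet (is_iet_inv (iet_funK f) (iet_inv_funK f) (ietP f)).

Lemma iet_mulA : associative iet_mul.
Proof. by move=> f g h; apply: val_inj. Qed.

Lemma iet_mul1 : left_id iet_one iet_mul.
Proof. by move=> f; apply: val_inj. Qed.

Lemma iet_mulr1 : right_id iet_one iet_mul.
Proof. by move=> f; apply: val_inj. Qed.

Lemma iet_mulV : left_inverse iet_one iet_inv iet_mul.
Proof. by move=> f; apply: val_inj; apply/funext => x /=; rewrite iet_funK. Qed.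

Lemma iet_mulrV : right_inverse iet_one iet_inv iet_mul.
Proof.
by move=> f; apply: val_inj; apply/funext => x /=; rewrite iet_inv_funK.
Qed.

HB.instance Definition _ :=
  isGroup.Build (IET R) iet_mulA iet_mul1 iet_mulr1 iet_mulV iet_mulrV.

End group.

Section reversibility.
Local Open Scope group_scope.
Context {G : groupType}.
Implicit Types f h : G.

Definition reversible_by f h : Prop := h * f * h^-1 = f^-1.

Definition reversible f : Prop := exists h, reversible_by f h.

(* The identity counts as an involution. *)
Definition involution h : Prop := h ^+ 2 = 1.

Definition has_order h (n : nat) : Prop :=
  [/\ (0 < n)%N, h ^+ n = 1 & forall m, (0 < m)%N -> h ^+ m = 1 -> (n <= m)%N].

Definition finite_order h : Prop := exists n, has_order h n.

End reversibility.

(* Main.v *)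
Require Import Defs.
From HB Require Import structures.
From mathcomp Require Import all_boot all_order all_algebra.
From mathcomp Require Import boolp reals numfun.
From mathcomp Require Import lra zify classical_sets.

(** Let h f h^-1 = f^-1. We modify h on finitely many f-invariant finite unions
    of intervals so that some power h^(2^a) becomes trivial; the order is then a
    power of 2.

    On the periodic points of f, whose periods are bounded, the orbits are
    finite and f^i x |-> f^-i x, with x the least point of its orbit, is an
    involution reversing f. Elsewhere, h^2 commutes with f. At periodic points of
    h, an odd power of h has order a power of 2. Where h^2n = f^k with k <> 0, the
    sign of k is f-invariant and changed by h, and the involution equal to h
    where k > 0 and to h^-1 where k < 0 reverses f.

    It remains to treat the set W where h^2n x is never in the f-orbit of x. Call
    x special if the left germs which are asymptotic to the orbit of x in the
    future and in the past differ. Special points form finitely many f-orbits,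
    permuted by h, so by the pigeonhole principle none lies in W. Hence
    on W one may glue to each right germ the left germ asymptotic to it: this
    makes W a finite union of circles on which f and h act by isometries, i.e.
    commute with the unit speed flow. Then f rotates circles by an angle which h
    changes to its opposite, and the direction of the first close return of x
    to itself under f again splits W into two halves exchanged by h. *)

Set Implicit Arguments.
Unset Strict Implicit.
Unset Printing Implicit Defensive.

Import Order.TTheory GRing.Theory Num.Theory.

Local Open Scope ring_scope.

(** * Piecewise translations *)

Section Piecewise.
Context {R : realType}.
Implicit Types (x y z t u v : R) (s : seq R) (Q : R -> R -> Prop) (A : R -> Prop).

Definition no_break s x y := forall p, p \in s -> ~~ (x < p <= y).

(** Pieces have the form [[p, p')]: a break is the first point of its piece, so it may equal [x] but
    not lie in [(x, y]]. A relation between two points of one piece serves for sets and translations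
    alike. *)
Definition piecewise Q :=
  exists s, forall x y, x <= y -> no_break s x y -> Q x y.

Lemma no_break_sub s s' x y x' y' : {subset s' <= s} -> x <= x' -> y' <= y ->
  no_break s x y -> no_break s' x' y'.
Proof.
move=> ss xx yy nb p ps; apply/negP => /andP[h1 h2].
have := nb p (ss p ps); rewrite (le_lt_trans xx h1) (le_trans h2 yy).
by [].
Qed.

Lemma piecewiseW Q Q' : (forall x y, x <= y -> Q x y -> Q' x y) ->
  piecewise Q -> piecewise Q'.
Proof. by move=> QQ [s h]; exists s => x y xy /(h x y xy); exact: QQ. Qed.

Lemma piecewiseI Q Q' : piecewise Q -> piecewise Q' ->
  piecewise (fun x y => Q x y /\ Q' x y).
Proof.
move=> [s h] [s' h']; exists (s ++ s') => x y xy nb.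
by split; [apply: h|apply: h'] => //; apply: no_break_sub nb => // p;
  rewrite mem_cat => ->; rewrite ?orbT.
Qed.

Lemma piecewiseT Q : (forall x y, x <= y -> Q x y) -> piecewise Q.
Proof. by move=> h; exists [::] => x y xy _; apply: h. Qed.

Lemma piecewise_all (n : nat) (Q : nat -> R -> R -> Prop) :
  (forall i, (i < n)%N -> piecewise (Q i)) ->
  piecewise (fun x y => forall i, (i < n)%N -> Q i x y).
Proof.
elim: n => [|n ih] h; first exact: piecewiseT.
have := piecewiseI (ih (fun i ni => h i (ltnW ni))) (h n (ltnSn n)).
apply: piecewiseW => x y _ [h1 h2] i; rewrite ltnS leq_eqVlt => /orP[/eqP -> //|].
exact: h1.
Qed.

Lemma finite_gap s x : exists2 d : R, 0 < d &
  forall p, p \in s -> p != x -> d <= `|p - x|.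
Proof.
elim: s => [|q s [d d0 h]]; first by exists 1.
have [->|qx] := eqVneq q x.
  exists d => // p; rewrite inE => /orP[/eqP ->|]; [by rewrite eqxx|exact: h].
exists (Num.min d `|q - x|); first by rewrite lt_min d0 normr_gt0 subr_eq0.
move=> p; rewrite inE => /orP[/eqP -> _|ps px]; first by rewrite ge_min lexx orbT.
by rewrite ge_min h.
Qed.

(** The asymmetry comes from the half-open pieces: [x] shares its piece with its right neighbours,
    but if it is a break its left neighbours lie in another one. *)
Lemma piecewise_near Q x : piecewise Q -> exists2 d : R, 0 < d &
  (forall t, 0 <= t < d -> Q x (x + t)) /\
  (forall u v, x - d < u -> u <= v -> v < x -> Q u v).
Proof.
move=> [s h]; have [d d0 gap] := finite_gap s x; exists d => //.
split=> [t /andP[t0 td]|u v xu uv vx]; apply: h => //; first by lra.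
  move=> p /gap; case: eqP => [->|_ /(_ isT)]; first by rewrite ltxx.
  by rewrite ler_normr; lra.
move=> p /gap; case: eqP => [->|_ /(_ isT)]; first by lra.
by rewrite ler_normr; lra.
Qed.

Lemma piecewise_cofinite Q : piecewise Q -> exists s, forall x, x \notin s ->
  exists2 d : R, 0 < d & forall u v, x - d < u -> u <= v -> v <= x -> Q u v.
Proof.
move=> [s h]; exists s => x xs; have [d d0 gap] := finite_gap s x; exists d => //.
move=> u v xu uv vx; apply: h => // p ps; apply/negP => /andP[up pv].
have px : p != x by apply: contraNneq xs => <-.
by have := gap p ps px; rewrite ler_normr; lra.
Qed.

Definition pw_set A := piecewise (fun x y => A x <-> A y).

Definition pw_trans (phi : R -> R) :=
  piecewise (fun x y => phi y = phi x + (y - x)).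

Lemma pw_setC A : pw_set A -> pw_set (fun x => ~ A x).
Proof. by apply: piecewiseW => x y _ [h1 h2]; tauto. Qed.

Lemma pw_setI A B : pw_set A -> pw_set B -> pw_set (fun x => A x /\ B x).
Proof.
by move=> a b; apply: piecewiseW (piecewiseI a b) => x y _ [[? ?] [? ?]]; tauto.
Qed.

Lemma pw_setU A B : pw_set A -> pw_set B -> pw_set (fun x => A x \/ B x).
Proof.
by move=> a b; apply: piecewiseW (piecewiseI a b) => x y _ [[? ?] [? ?]]; tauto.
Qed.

Lemma pw_set_exists (n : nat) (A : nat -> R -> Prop) :
  (forall i, (i < n)%N -> pw_set (A i)) ->
  pw_set (fun x => exists2 i, (i < n)%N & A i x).
Proof.
move=> h; apply: piecewiseW (piecewise_all h) => x y _ hA.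
by split=> -[i ni Ai]; exists i => //; apply/(hA i ni).
Qed.

Lemma pw_set_forall (n : nat) (A : nat -> R -> Prop) :
  (forall i, (i < n)%N -> pw_set (A i)) ->
  pw_set (fun x => forall i, (i < n)%N -> A i x).
Proof.
move=> h; apply: piecewiseW (piecewise_all h) => x y _ hA.
by split=> Ai i ni; apply/(hA i ni); apply: Ai.
Qed.

Lemma eq_pw_set A B : (forall x, A x <-> B x) -> pw_set A -> pw_set B.
Proof. by move=> AB; apply: piecewiseW => x y _ h; rewrite -!AB. Qed.

Lemma pw_trans_glue (n : nat) (A : nat -> R -> Prop) (psi : nat -> R -> R) phi :
  (forall i, (i < n)%N -> pw_set (A i)) ->
  (forall i, (i < n)%N -> pw_trans (psi i)) ->
  (forall i x, (i < n)%N -> A i x -> phi x = psi i x) ->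
  (forall x, exists2 i, (i < n)%N & A i x) -> pw_trans phi.
Proof.
move=> pA ppsi phiE cov.
apply: piecewiseW (piecewiseI (piecewise_all pA) (piecewise_all ppsi)).
move=> x y _ [hA hpsi]; have [i ni Ai] := cov x.
rewrite (phiE i x ni Ai) (phiE i y ni) ?hpsi//.
exact/hA.
Qed.

End Piecewise.

(** * The action of the group on the real line *)

Section Action.
Context {R : realType}.
Local Notation G := (IET R).
Implicit Types (f g k : G) (x y z t u v a b : R) (s : seq R).

(* IETs are extended by the identity outside [0, 1); the point 1, which
   carries a left germ but is not in [0, 1), then needs no special treatment. *)
Definition act g x : R :=
  if insub x is Some w then val (val g w) else x.

Lemma act_val g (w : unit_itv R) : act g (val w) = val (val g w).
Proof. by rewrite /act valK. Qed.

Lemma act_out g x : ~~ (0 <= x < 1) -> act g x = x.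
Proof. by move=> h; rewrite /act insubN. Qed.

Lemma act1 x : act 1%g x = x.
Proof.
have [h|/act_out -> //] := boolP (0 <= x < 1).
by have [w <-] := sub_uitvP h; rewrite act_val.
Qed.

Lemma actM g k x : act (g * k)%g x = act g (act k x).
Proof.
have [h|h] := boolP (0 <= x < 1); last by rewrite !act_out.
by have [w <-] := sub_uitvP h; rewrite !act_val.
Qed.

Lemma actK g : cancel (act g) (act g^-1%g).
Proof. by move=> x; rewrite -actM mulVg act1. Qed.

Lemma actVK g : cancel (act g^-1%g) (act g).
Proof. by move=> x; rewrite -actM mulgV act1. Qed.

Lemma act_inj g : injective (act g).
Proof. exact: can_inj (actK g). Qed.

Lemma actS g n x : act (g ^+ n.+1)%g x = act g (act (g ^+ n)%g x).
Proof. by rewrite expgS actM. Qed.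

Lemma actSr g n x : act (g ^+ n.+1)%g x = act (g ^+ n)%g (act g x).
Proof. by rewrite expgSr actM. Qed.

Lemma actD g m n x : act (g ^+ (m + n))%g x = act (g ^+ m)%g (act (g ^+ n)%g x).
Proof. by rewrite expgnDr actM. Qed.

Lemma act_eq g k : act g =1 act k -> g = k.
Proof.
move=> h; apply: val_inj; apply/funext => w; apply: val_inj.
by rewrite -!act_val h.
Qed.

Lemma act_trans g : pw_trans (act g).
Proof.
have [s hs] := iet_breaks (ietP g).
exists (0 :: 1 :: s) => x y xy nb.
have : ~~ (x < 0 <= y) by apply: nb; rewrite inE eqxx.
have : ~~ (x < 1 <= y) by apply: nb; rewrite !inE eqxx orbT.
have [hx|hx] := boolP (0 <= x < 1) => h1 h0.
  have hy : 0 <= y < 1 by lra.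
  move: xy nb; have [w <-] := sub_uitvP hx; have [w' <-] := sub_uitvP hy => xy nb.
  rewrite !act_val; apply: hs => // p ps; apply: nb.
  by rewrite !inE ps !orbT.
rewrite (act_out _ hx) act_out; lra.
Qed.

(* The two translated pieces move together, so their relative position is
   constant on each piece. *)
Lemma pw_set_eq g k : pw_set (fun x => act g x = act k x).
Proof.
apply: piecewiseW (piecewiseI (act_trans g) (act_trans k)) => x y _ [-> ->].
by split=> [->//|/addIr].
Qed.

Lemma pw_set_le g k : pw_set (fun x => act g x <= act k x).
Proof.
apply: piecewiseW (piecewiseI (act_trans g) (act_trans k)) => x y _ [-> ->].
by rewrite lerD2r.
Qed.

Lemma act_of (phi psi : R -> R) : cancel phi psi -> cancel psi phi ->
  (forall x, ~~ (0 <= x < 1) -> phi x = x) -> pw_trans phi ->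
  exists g, act g =1 phi.
Proof.
move=> phiK psiK out [s hs].
(* An image outside [[0, 1)] would be fixed by [phi], hence equal to [x] by injectivity. *)
have inphi x : 0 <= x < 1 -> 0 <= phi x < 1.
  move=> hx; apply/negPn/negP => h; have := out _ h.
  by move/(can_inj phiK) => e; rewrite e hx in h.
have inpsi x : 0 <= x < 1 -> 0 <= psi x < 1.
  move=> hx; apply/negPn/negP => h; have := out _ h.
  by rewrite psiK => e; rewrite -e hx in h.
pose p0 (w : unit_itv R) : unit_itv R := exist _ (phi (val w)) (inphi _ (valP w)).
pose p1 (w : unit_itv R) : unit_itv R := exist _ (psi (val w)) (inpsi _ (valP w)).
have bij : bijective p0.
  by exists p1 => w; apply: val_inj => /=; rewrite ?phiK ?psiK.
have p0s : breaks p0 s by move=> w w' ww nb; apply: hs.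
exists (mk_iet (breaks_iet bij p0s)) => x.
have [h|h] := boolP (0 <= x < 1); last by rewrite act_out ?out.
by have [w <-] := sub_uitvP h; rewrite act_val.
Qed.

End Action.

(** * Germs *)

Section Germs.
Context {R : realType}.
Local Notation G := (IET R).
Implicit Types (f g k : G) (x y z t u v a b : R) (s : seq R).

Lemma escape (u : nat -> R) s : injective u ->
  exists M, forall m, (M <= m)%N -> u m \notin s.
Proof.
move=> uI; elim: s => [|p s [M hM]]; first by exists 0%N.
have [[i ui]|no] := pselect (exists i, u i = p).
  exists (maxn M i.+1) => m; rewrite geq_max => /andP[Mm im].
  rewrite inE negb_or hM// andbT -ui.
  by apply/eqP => /uI mi; rewrite mi ltnn in im.
exists M => m Mm; rewrite inE negb_or hM// andbT.
by apply/eqP => um; apply: no; exists m.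
Qed.

(** The left limit [y] of [act g] at [x] may differ from [act g x] when [x] is a break. *)
Definition left_germ g x y :=
  exists2 d : R, 0 < d & forall t, 0 < t < d -> act g (x - t) = y - t.

Lemma left_germ_ex g x : exists y, left_germ g x y.
Proof.
have [d d0 [_ h]] := piecewise_near x (act_trans g).
exists (act g (x - d / 2) + d / 2), (d / 2) => [|t /andP[t0 td]]; first by lra.
have : x - d < x - d / 2 by lra.
by move/h => /(_ (x - t)) ->; lra.
Qed.

Lemma common_lt (d d' : R) : 0 < d -> 0 < d' ->
  exists2 e, 0 < e & e < d /\ e < d'.
Proof.
move=> h h'; exists (Num.min d d' / 2); first by rewrite divr_gt0// lt_min h.
by case: (leP d d'); lra.
Qed.

Lemma left_germ_uniq g x y y' : left_germ g x y -> left_germ g x y' -> y = y'.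
Proof.
move=> [d d0 h] [d' d0' h']; have [e e0 [ed ed']] := common_lt d0 d0'.
by have := h e; rewrite h' ?e0//= => /(_ ed); lra.
Qed.

Lemma left_germM g k x y z : left_germ g x y -> left_germ k y z ->
  left_germ (k * g)%g x z.
Proof.
move=> [d d0 h] [d' d0' h']; have [e e0 [ed ed']] := common_lt d0 d0'.
exists e => // t /andP[t0 te]; rewrite actM h ?h'//; lra.
Qed.

Lemma left_germV g x y : left_germ g x y -> left_germ g^-1%g y x.
Proof. by move=> [d d0 h]; exists d => // t /h <-; rewrite actK. Qed.

Lemma left_germ_inj g x x' y : left_germ g x y -> left_germ g x' y -> x = x'.
Proof. by move=> /left_germV h /left_germV; apply: left_germ_uniq. Qed.

Lemma left_germ_cofinite g : exists s, forall x, x \notin s ->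
  left_germ g x (act g x).
Proof.
have [s hs] := piecewise_cofinite (act_trans g); exists s => x /hs[d d0 h].
exists d => // t /andP[t0 td].
by have := h (x - t) x; rewrite lexx => -> //; lra.
Qed.

Lemma conjX g g' k m : (k * g = g' * k)%g -> (k * g ^+ m = g' ^+ m * k)%g.
Proof.
move=> kg; elim: m => [|m ih]; first by rewrite !expg0 mulg1 mul1g.
by rewrite !expgS mulgA kg -mulgA ih mulgA.
Qed.

Lemma conjV g g' k : (k * g = g' * k)%g -> (k * g^-1 = g'^-1 * k)%g.
Proof. by move=> kg; apply: (mulgI g'); rewrite mulgA -kg mulgK mulVKg. Qed.

Lemma conj_sym g g' k : (k * g = g' * k)%g -> (k^-1 * g' = g * k^-1)%g.
Proof. by move=> kg; apply: (mulgI k); rewrite mulVKg mulgA kg mulgK. Qed.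

Lemma act_conjX g g' k m x : (k * g = g' * k)%g ->
  act k (act (g ^+ m)%g x) = act (g' ^+ m)%g (act k x).
Proof. by move=> kg; rewrite -!actM (conjX m kg). Qed.

Lemma act_conj g g' k x : (k * g = g' * k)%g ->
  act k (act g x) = act g' (act k x).
Proof. by move=> kg; rewrite -!actM kg. Qed.

Lemma actXV g m x : act (g^-1 ^+ m)%g x = act (g ^+ m)^-1%g x.
Proof. by rewrite expVgn. Qed.

Definition aperiodic g x := forall n, (0 < n)%N -> act (g ^+ n)%g x <> x.

Lemma aperiodic_inj g x : aperiodic g x -> injective (fun m => act (g ^+ m)%g x).
Proof.
move=> ap i j; wlog ij : i j / (i < j)%N => [th|e].
  by case: (ltngtP i j) => // ij e; [exact: th|apply/esym/th].
move: e; rewrite -(subnKC (ltnW ij)) actD => /act_inj/esym/ap.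
by rewrite subn_gt0 => /(_ ij).
Qed.

Lemma aperiodicV g x : aperiodic g x -> aperiodic g^-1%g x.
Proof.
move=> ap n n0; rewrite actXV => e; apply: (ap n n0).
by rewrite -{1}e actVK.
Qed.

Lemma aperiodic_conj g g' k x : (k * g = g' * k)%g -> aperiodic g x ->
  aperiodic g' (act k x).
Proof. by move=> kg ap n n0; rewrite -(act_conjX _ _ kg) => /act_inj/ap; apply. Qed.

(* [glued g a b]: far along the forward g-orbit, the germ to the left of b ends
   at the orbit of a. *)
Definition glued g a b := exists M, forall m, (M <= m)%N ->
  left_germ (g ^+ m)%g b (act (g ^+ m)%g a).

Lemma glued_uniql g a a' b : glued g a b -> glued g a' b -> a = a'.
Proof.
move=> [M h] [M' h']; pose m := maxn M M'; apply: (@act_inj _ (g ^+ m)%g).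
by apply: left_germ_uniq (h m _) (h' m _); rewrite ?leq_maxl ?leq_maxr.
Qed.

Lemma glued_uniqr g a b b' : glued g a b -> glued g a b' -> b = b'.
Proof.
move=> [M h] [M' h']; pose m := maxn M M'.
by apply: left_germ_inj (h m _) (h' m _); rewrite ?leq_maxl ?leq_maxr.
Qed.

(** By aperiodicity the forward orbit of [a] finally leaves the breaks of [k]; from then on [k]
    carries the left germs along the orbit as it carries its points. *)
Lemma glued_conj g g' k a b b' : (k * g = g' * k)%g -> aperiodic g a ->
  left_germ k b b' -> glued g a b -> glued g' (act k a) b'.
Proof.
move=> kg ap kb [M h]; have [s hs] := left_germ_cofinite k.
have [M' h'] := escape s (aperiodic_inj ap).
exists (maxn M M') => m; rewrite geq_max => /andP[/h hm /h' /hs hm'].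
have := left_germM (left_germM (left_germV kb) hm) hm'.
by rewrite mulgA (conjX m kg) mulgK (act_conjX _ _ kg).
Qed.

Lemma glued_self g : exists s, forall x,
  (forall i, act (g ^+ i)%g x \notin s) -> glued g x x.
Proof.
have [s hs] := left_germ_cofinite g; exists s => x xs; exists 0%N => m _.
elim: m => [|m ih]; last by rewrite expgS actM; apply: left_germM ih (hs _ (xs m)).
by rewrite expg0 act1; exists 1 => // t _; rewrite act1.
Qed.

Definition left_in (W : R -> Prop) b :=
  exists2 d : R, 0 < d & forall t, 0 < t < d -> W (b - t).

Lemma invariantX (W : R -> Prop) g : (forall x, W (act g x) <-> W x) ->
  forall m x, W (act (g ^+ m)%g x) <-> W x.
Proof.
by move=> Wg; elim=> [|m ih] x; rewrite ?expg0 ?act1// expgS actM Wg ih.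
Qed.

(** The successive images of the left germ at [b] are distinct, hence eventually avoid the breaks of
    [g] and of [W]. From then on they move like points of [W], and pulling one back along [g] gives
    [a]. *)
Lemma glued_ex (W : R -> Prop) g b : pw_set W ->
  (forall x, W (act g x) <-> W x) -> (forall x, W x -> aperiodic g x) ->
  left_in W b -> exists2 a, W a & glued g a b.
Proof.
move=> pW Wf ap [d d0 Wb]; have Wg := invariantX Wf.
have [y hy] := choice (fun m => left_germ_ex (g ^+ m)%g b).
have step m n : left_germ (g ^+ n)%g (y m) (y (m + n)%N).
  have := left_germM (left_germV (hy m)) (hy (m + n)%N).
  by rewrite addnC expgnDr mulgK.
have yI : injective y.
  move=> i j; wlog ij : i j / (i < j)%N => [th|e].
    by case: (ltngtP i j) => // ij e; [exact: th|apply/esym/th].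
  (* A coincidence would make a positive power of [g] fix points of [W] just to the left of
     [y i]. *)
  have := step i (j - i)%N; rewrite subnKC 1?ltnW// -e => -[d1 d10 h1].
  have [d2 d20 h2] := hy i.
  have [e1 e10 [e1d e1d1]] := common_lt d0 d10.
  have [t t0 [te td2]] := common_lt e10 d20.
  have tE : 0 < t < d2 by rewrite t0.
  have Wt : W (y i - t).
    by rewrite -h2// Wg; apply: Wb; rewrite t0 (lt_trans te).
  have /(ap _ Wt) : (0 < j - i)%N by rewrite subn_gt0.
  by case; apply: h1; rewrite t0 (lt_trans te).
have [s hs] := left_germ_cofinite g; have [s' hs'] := piecewise_cofinite pW.
have [M hM] := escape (s ++ s') yI.
have yM m : (M <= m)%N -> y m \notin s /\ y m \notin s'.
  by move=> /hM; rewrite mem_cat negb_or => /andP.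
have yE n : y (M + n)%N = act (g ^+ n)%g (y M).
  elim: n => [|n ih]; first by rewrite addn0 expg0 act1.
  rewrite actS -ih; have [/hs ns _] := yM _ (leq_addr n M).
  by apply: left_germ_uniq ns; have := step (M + n)%N 1%N; rewrite expg1 addn1 addnS.
exists (act (g ^+ M)^-1%g (y M)).
  rewrite -(Wg M) actVK; have [_ /hs'[d1 d10 h1]] := yM M (leqnn M).
  have [d2 d20 h2] := hy M.
  have [e1 e10 [e1d e1d1]] := common_lt d0 d10.
  have [t t0 [te td2]] := common_lt e10 d20.
  have h : W (y M - t).
    by rewrite -h2 ?t0// Wg; apply: Wb; rewrite t0 (lt_trans te).
  by apply: (iffLR (h1 (y M - t) (y M) _ _ _) h); lra.
by exists M => m Mm; rewrite -{2}(subnK Mm) actD actVK -yE subnKC.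
Qed.

(* A point is special if the f-orbit of its right germ and the two ends of the
   f-orbits of left germs do not match up. *)
Definition special f x := exists b, ~ (glued f x b <-> glued f^-1%g x b).

Lemma specialV f x : special f^-1%g x <-> special f x.
Proof. by split=> -[b]; rewrite ?invgK => h; exists b; rewrite ?invgK; tauto. Qed.

Lemma special_conj g g' k x : (k * g = g' * k)%g -> aperiodic g x ->
  special g x -> special g' (act k x).
Proof.
move=> kg ap [b hb]; have [c hc] := left_germ_ex k b; exists c.
have ap' := aperiodic_conj kg ap.
have kgV := conjV kg; have kg' := conj_sym kg; have kgV' := conj_sym kgV.
have h1 := glued_conj kg ap hc.
have h2 := glued_conj kgV (aperiodicV ap) hc.
have h3 := glued_conj kg' ap' (left_germV hc).
have h4 := glued_conj kgV' (aperiodicV ap') (left_germV hc).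
by rewrite !actK in h3 h4; tauto.
Qed.

(** If the forward orbit avoids the breaks of [f] and the backward orbit those of [f^-1], then [x]
    is glued to itself in both directions, hence by uniqueness to nothing else, and is not
    special. *)
Lemma special_orbit f : exists s, forall x, special f x -> exists i,
  act (f ^+ i)%g x \in s \/ act (f^-1 ^+ i)%g x \in s.
Proof.
have [s hs] := glued_self f; have [s' hs'] := glued_self f^-1%g.
exists (s ++ s') => x [b hb]; apply: contrapT => no; apply: hb.
have xs : glued f x x.
  apply: hs => i; apply/negP => h; apply: no; exists i; left.
  by rewrite mem_cat h.
have xs' : glued f^-1%g x x.
  apply: hs' => i; apply/negP => h; apply: no; exists i; right.
  by rewrite mem_cat h orbT.
by split=> [/glued_uniqr/(_ xs) ->|/glued_uniqr/(_ xs') ->].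
Qed.

End Germs.

(** * The flow on glued intervals *)

(** The supremum of the points up to which [P] holds satisfies [P] by the left step; were it below
    [b], the right step would pass it. *)
Lemma real_induction (R : realType) (P : R -> Prop) (a b : R) : a <= b -> P a ->
  (forall y, a <= y < b -> P y ->
    exists2 d, 0 < d & forall t, 0 < t < d -> P (y + t)) ->
  (forall y, a < y <= b -> (forall u, a <= u < y -> P u) -> P y) -> P b.
Proof.
move=> ab Pa right left.
pose S : set R := fun y => a <= y <= b /\ forall u, a <= u <= y -> P u.
have Sa : S a by split=> [|u /le_anti <- //]; rewrite lexx.
have supS : has_sup S by split; [exists a|exists b => y [/andP[]]].
have ac : a <= sup S by apply: ub_le_sup => //; case: supS.
have cb : sup S <= b by apply: ge_sup => [|y [/andP[]]//]; exists a.
have Pltc u : a <= u < sup S -> P u.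
  move=> /andP[au uc]; have d0 : 0 < sup S - u by lra.
  by have [y [_ Sy] yu] := sup_adherent d0 supS; apply: Sy; lra.
have Pc : P (sup S).
  by have [->//|ac'] := eqVneq (sup S) a; apply: left => //; lra.
have [cb'|] := ltP (sup S) b; last first.
  by move=> bc; have -> : b = sup S by lra.
have [|d d0 hd] := right (sup S) _ Pc; first by lra.
pose y := Num.min b (sup S + d / 2).
have [cy yb yd] : [/\ sup S < y, y <= b & y < sup S + d].
  by rewrite /y; case: (leP b (sup S + d / 2)); split; lra.
suff : S y by move/(ub_le_sup (proj2 supS)); lra.
split=> [|u /andP[au uy]]; first by lra.
have [uc|cu] := ltP u (sup S); first by apply: Pltc; rewrite au.
have [->//|cu'] := eqVneq u (sup S).
have -> : u = sup S + (u - sup S) by lra.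
by apply: hd; lra.
Qed.

(* Gluing each left germ b of W to the right germ gl b turns W into a finite
   union of circles; [flow t] is the unit speed flow on it, for t < eps. *)
Section Flow.
Context {R : realType} (W : R -> Prop) (gl : R -> R) (B : seq R) (eps : R).
Implicit Types (x y z s t u v a b : R).
Context (pW : pw_set W) (gl_in : forall b, left_in W b -> W (gl b))
  (gl_B : forall b, left_in W b -> gl b != b -> b \in B)
  (B_gl : forall b, b \in B -> left_in W b /\ gl b != b)
  (eps0 : 0 < eps)
  (gapBB : forall b b', b \in B -> b' \in B -> b' != b -> eps <= `|b' - b|)
  (gapBg : forall b b', b \in B -> b' \in B -> b' != gl b -> eps <= `|b' - gl b|)
  (gapgg : forall b b', b \in B -> b' \in B -> gl b' != gl b ->
     eps <= `|gl b' - gl b|)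
  (gl_inj : forall b b', left_in W b -> left_in W b' -> gl b = gl b' -> b = b').

(** Distinct points of [B] are [eps] apart, so for [t < eps] all entries of the filtered list
    coincide and its head is the only jump; [x + t - b] is the time left after it. *)
Definition flow t x : R :=
  if [seq b <- B | x < b <= x + t] is b :: _ then gl b + (x + t - b) else x + t.

Lemma flow_free t x : no_break B x (x + t) -> flow t x = x + t.
Proof.
move=> nb; rewrite /flow; case E: [seq b <- B | _] => [//|b l].
have : b \in [seq b <- B | x < b <= x + t] by rewrite E mem_head.
by rewrite mem_filter => /andP[h /nb]; rewrite h.
Qed.

Lemma flow_jump t x b : t < eps -> b \in B -> x < b <= x + t ->
  flow t x = gl b + (x + t - b).
Proof.
move=> te bB xb; rewrite /flow; case E: [seq b <- B | _] => [|c l].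
  have : b \in [seq b <- B | x < b <= x + t] by rewrite mem_filter xb.
  by rewrite E.
have : c \in [seq b <- B | x < b <= x + t] by rewrite E mem_head.
rewrite mem_filter => /andP[xc cB].
have [->//|cb] := eqVneq c b.
by have := gapBB bB cB cb; rewrite ler_normr; lra.
Qed.

Lemma flow_dec t x : no_break B x (x + t) \/ exists2 b, b \in B & x < b <= x + t.
Proof.
have [[b h1 h2]|no] := pselect (exists2 b, b \in B & x < b <= x + t).
  by right; exists b.
by left=> b bB; apply/negP => xb; apply: no; exists b.
Qed.

Lemma no_break_after_jump b t : b \in B -> t < eps -> no_break B (gl b) (gl b + t).
Proof.
move=> bB te c cB; apply/negP => /andP[h1 h2].
have cb : c != gl b by apply: contraTneq h1 => ->; rewrite ltxx.
by have := gapBg bB cB cb; rewrite ler_normr; lra.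
Qed.

Lemma no_break_before_jump b x y t : b \in B -> x < b <= x + t -> t < eps ->
  y < b -> no_break B x y.
Proof.
move=> bB xb te yb c cB; apply/negP => /andP[h1 h2].
have cb : c != b by apply: contraTneq h2 => ->; rewrite -ltNge.
by have := gapBB bB cB cb; rewrite ler_normr; lra.
Qed.

(** Real induction: the left germ at a limit point [z] lies in [W] and, as [z] is not in [B], is
    glued to [z] itself, so [z] is in [W]. *)
Lemma run_in x y : W x -> x <= y -> no_break B x y -> W y.
Proof.
move=> Wx xy nb; apply: (real_induction xy) => //.
  move=> z _ Wz; have [d d0 [h _]] := piecewise_near z pW.
  by exists d => // t /andP[t0 td]; apply: (iffLR (h t _) Wz); lra.
move=> z /andP[xz zy] Wu.
have lz : left_in W z by exists (z - x) => [|t tz]; [|apply: Wu]; lra.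
have [<-|/(gl_B lz) /nb] := eqVneq (gl z) z; first exact: gl_in.
by rewrite xz zy.
Qed.

Lemma flow_in t x : W x -> 0 <= t < eps -> W (flow t x).
Proof.
move=> Wx /andP[t0 te]; have [nb|[b bB xb]] := flow_dec t x.
  by rewrite flow_free//; apply: run_in nb => //; lra.
have [lb _] := B_gl bB; rewrite (flow_jump te bB xb).
apply: (run_in (gl_in lb)); first by lra.
by apply: no_break_after_jump => //; lra.
Qed.

Lemma flow0 x : flow 0 x = x.
Proof. by rewrite flow_free ?addr0// => b _; apply/negP; lra. Qed.

Lemma flowD s t x : 0 <= s -> 0 <= t -> s + t < eps ->
  flow s (flow t x) = flow (s + t) x.
Proof.
move=> s0 t0 ste; have [nb|[b bB xb]] := flow_dec t x.
  rewrite (flow_free nb); have [nb'|[b bB xb]] := flow_dec s (x + t).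
    rewrite flow_free// flow_free; first by lra.
    move=> b bB; apply/negP => xb; have := nb b bB; have := nb' b bB.
    by move=> /negP h1 /negP h2; have := ltP (x + t) b => -[h|h];
      [apply: h1|apply: h2]; lra.
  by rewrite !(@flow_jump _ _ b) //; lra.
rewrite !(@flow_jump _ x b) //; [|lra..].
rewrite flow_free; first by lra.
have se : s + (x + t - b) < eps by lra.
apply: no_break_sub (no_break_after_jump bB se) => //; lra.
Qed.

Lemma flow_neq t x : 0 < t < eps -> flow t x <> x.
Proof.
move=> /andP[t0 te]; have [nb|[b bB xb]] := flow_dec t x.
  by rewrite flow_free//; lra.
have [_ /eqP glb] := B_gl bB.
rewrite (flow_jump te bB xb) => e.
(* A return to [x] after the jump puts [b] at distance [t < eps] from [gl b]. *)
have bg : b != gl b by apply/eqP => /esym.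
by have := gapBg bB bB bg; rewrite ler_normr; lra.
Qed.

Lemma flow_right x : exists2 d, 0 < d & forall t, 0 <= t < d -> flow t x = x + t.
Proof.
have [d d0 gap] := finite_gap B x; exists d => // t td.
apply: flow_free => b /gap; case: eqP => [->|_ /(_ isT)]; first by rewrite ltxx.
by rewrite ler_normr; lra.
Qed.

(** This is left continuity of the flow lines for the gluing. The jump is absent, or occurs exactly
    at time [t], or earlier. *)
Lemma flow_left x t : W x -> 0 < t < eps -> exists b, [/\ left_in W b,
  gl b = flow t x &
  exists2 d, 0 < d & forall s, 0 < s < d -> flow (t - s) x = b - s].
Proof.
move=> Wx /andP[t0 te]; have [nb|[c cB xc]] := flow_dec t x.
  have fE s : 0 < s < t -> flow (t - s) x = x + t - s.
    move=> st; rewrite flow_free; first by lra.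
    by apply: no_break_sub nb => //; lra.
  have lb : left_in W (x + t).
    by exists t => // s st; rewrite -fE//; apply: flow_in => //; lra.
  exists (x + t); split=> //; last by exists t.
  rewrite flow_free//; apply: contrapT => /eqP /(gl_B lb) /nb.
  by rewrite lexx; lra.
have [cE|cE] := eqVneq c (x + t).
  exists c; split; first by have [] := B_gl cB.
    by rewrite (flow_jump te cB xc); lra.
  exists t => // s st; rewrite flow_free; first by lra.
  by apply: no_break_before_jump xc te _ => //; lra.
have cxt : c < x + t by rewrite lt_neqAle cE; lra.
have fE s : 0 <= s < x + t - c -> flow (t - s) x = gl c + (x + t - c) - s.
  by move=> st; rewrite (@flow_jump _ _ c)//; lra.
have lb : left_in W (gl c + (x + t - c)).
  exists (x + t - c); first by lra.
  by move=> s st; rewrite -fE; [apply: flow_in => //|]; lra.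
exists (gl c + (x + t - c)); split=> //.
  rewrite (flow_jump te cB xc); apply: contrapT => /eqP /(gl_B lb) h.
  have ge : x + t - c < eps by lra.
  by have /negP := no_break_after_jump cB ge h; apply; lra.
by exists (x + t - c) => [|s st]; [|apply: fE]; lra.
Qed.

(** Real induction on [t]: just after a given time both sides are translations, and at a limit time
    they are glued to left germs which [g] carries to each other. *)
Lemma flow_comm (g : IET R) t x : (forall y, W y -> W (act g y)) ->
  (forall b b', left_in W b -> left_germ g b b' -> gl b' = act g (gl b)) ->
  W x -> 0 <= t < eps -> act g (flow t x) = flow t (act g x).
Proof.
move=> Wg gg Wx /andP[t0 te].
apply: (@real_induction _ (fun t => act g (flow t x) = flow t (act g x)) _ _ t0).
- by rewrite !flow0.
- move=> y /andP[y0 yt] Py.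
  have [d1 d10 h1] := flow_right (flow y x).
  have [d2 d20 h2] := flow_right (flow y (act g x)).
  have [d3 d30 [h3 _]] := piecewise_near (flow y x) (act_trans g).
  have [e1 e10 [e1d1 e1d2]] := common_lt d10 d20.
  have [e2 e20 [e2e1 e2d3]] := common_lt e10 d30.
  have ye : 0 < eps - y by lra.
  have [e e0 [ee2 ey]] := common_lt e20 ye.
  exists e => // s /andP[s0 se].
  rewrite addrC -!flowD//; [|lra..].
  by rewrite h1 ?h2 ?h3 ?Py; lra.
- move=> y /andP[y0 yt] Pu; have ye : 0 < y < eps by lra.
  have [b [lb <- [d d0 h]]] := flow_left Wx ye.
  have [b' [lb' <- [d' d0' h']]] := flow_left (Wg _ Wx) ye.
  apply/esym/gg => //.
  have [e1 e10 [e1d1 e1d2]] := common_lt d0 d0'.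
  have [e e0 [ee1 ey]] := common_lt e10 y0.
  by exists e => // s se; rewrite -h -?h' ?Pu//; lra.
Qed.


Lemma flow_inj t x y : W x -> W y -> 0 <= t < eps -> flow t x = flow t y -> x = y.
Proof.
move=> Wx Wy /andP[t0 te].
(* If one point jumps and the other does not, the run of the latter reaches [gl b] from the left
   inside [W]. That left germ is then glued to [gl b], against injectivity of [gl], or [gl b] is a
   break on the run. *)
have mixed b z : b \in B -> W z -> no_break B z (z + t) -> z < gl b <= z + t -> False.
  move=> bB Wz nb zb; have [lb /eqP glb] := B_gl bB.
  have lg : left_in W (gl b).
    exists (gl b - z) => [|s st]; first by lra.
    apply: (run_in Wz); first by lra.
    by apply: no_break_sub nb => //; lra.
  have [/(gl_inj lg lb)//|/(gl_B lg) /nb] := eqVneq (gl (gl b)) (gl b).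
  by rewrite zb.
have [nx|[b bB xb]] := flow_dec t x; have [ny|[c cB yc]] := flow_dec t y.
- by rewrite !flow_free// => /addIr.
- rewrite (flow_free nx) (flow_jump te cB yc) => e.
  by case: (mixed c x cB Wx nx); lra.
- rewrite (flow_free ny) (flow_jump te bB xb) => e.
  by case: (mixed b y bB Wy ny); lra.
rewrite (flow_jump te bB xb) (flow_jump te cB yc).
have [lb _] := B_gl bB; have [lc _] := B_gl cB.
have [/(gl_inj lc lb) ->|cb] := eqVneq (gl c) (gl b); first by lra.
by have := gapgg bB cB cb; rewrite ler_normr; lra.
Qed.

End Flow.

(** * Finite cells and orientation by first returns *)

Lemma pigeonhole_nat (n : nat) (c : nat -> nat) : (forall i, c i < n)%N ->
  exists i j, (i < j <= n)%N /\ c i = c j.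
Proof.
move=> cn; pose F (i : 'I_n.+1) : 'I_n := Ordinal (cn i).
have /injectivePn[i [j ij /(congr1 val)/= e]] : ~~ injectiveb F.
  apply/negP => /injectiveP /leq_card; rewrite !card_ord ltnn//.
case: (ltngtP i j) => [lt|lt|/ord_inj e']; last by rewrite e' eqxx in ij.
  by exists i, j; rewrite lt -ltnS ltn_ord.
by exists j, i; rewrite lt -ltnS ltn_ord.
Qed.

Lemma ex_first (P : nat -> Prop) : (exists n, P n) ->
  exists2 n, P n & forall k, (k < n)%N -> ~ P k.
Proof.
move=> exP; have exb : exists n, `[< P n >] by case: exP => n Pn; exists n; apply/asboolP.
case: (ex_minnP exb) => n /asboolP Pn min; exists n => // k kn Pk.
by have := min k (introT (asboolP _) Pk); rewrite leqNgt kn.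
Qed.

Section Cells.
Context {R : realType}.
Implicit Types (x y d : R) (s : seq R).

(** A label of the piece containing [x], used as the colour in the pigeonhole argument. *)
Definition below s x := count (fun p => p <= x) s.

Lemma below_mono s x y : x <= y ->
  (below s x <= below s y)%N.
Proof. by move=> xy; apply: sub_count => p /= /le_trans; apply. Qed.

Lemma no_break_below s x y : x <= y ->
  below s x = below s y -> no_break s x y.
Proof.
move=> xy; elim: s => [|q s ih] //= e p.
have mono := below_mono s xy.
have qxy : ((q <= x)%R <= (q <= y)%R)%N.
  by case: (leP q x) => // qx; rewrite (le_trans qx xy).
have [e1 e2] : ((q <= x) = (q <= y) :> nat) /\
    below s x = below s y by lia.
rewrite inE => /orP[/eqP ->|]; last exact: ih.
by move: e1; rewrite (ltNge x); case: (q <= x); case: (q <= y).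
Qed.

Lemma grid d : 0 < d -> exists s, forall x y, 0 <= x -> y < 1 ->
  no_break s x y -> y - x < d.
Proof.
(* This choice gives [K * d > 1], so every multiple of [d] in [[0, 1)] is listed; the first one
   beyond [x] separates [x] from any [y >= x + d]. *)
move=> d0; pose K := (Num.trunc d^-1).+1.
exists [seq k%:R * d | k <- iota 0 K] => x y x0 y1 nb.
rewrite ltNge; apply/negP => dyx.
have xd0 : 0 <= x / d by rewrite divr_ge0// ltW.
have /andP[] := Num.Theory.truncn_itv xd0; set k := Num.trunc _.
rewrite ler_pdivlMr// ltr_pdivrMr// => h1 h2.
have kd : k.+1%:R * d = k%:R * d + d by rewrite -natr1 mulrDl mul1r.
have di0 : 0 <= d^-1 by rewrite invr_ge0 ltW.
have /andP[_] := Num.Theory.truncn_itv di0.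
rewrite -(ltr_pM2r d0) mulVf ?gt_eqF// => hK.
have kK : (k.+1 < K)%N.
  by rewrite -(ltr_nat R) -(ltr_pM2r d0); apply: lt_trans hK; lra.
have /nb : k.+1%:R * d \in [seq k%:R * d | k <- iota 0 K].
  by apply/mapP; exists k.+1 => //; rewrite mem_iota.
by rewrite h2 => /negP; apply; rewrite kd; lra.
Qed.

End Cells.

(* A point of W is oriented according to the direction of its first return,
   under f, to within eps / 2 along the flow. *)
Section Orientation.
Context {R : realType} (f h : IET R) (W : R -> Prop) (fl : R -> R -> R)
  (B : seq R) (eps : R).
Implicit Types (x y z s t u : R).
Context (hf : (h * f = f^-1 * h)%g) (pW : pw_set W)
  (W01 : forall x, W x -> 0 <= x < 1)
  (Wf : forall x, W (act f x) <-> W x) (Wh : forall x, W (act h x) <-> W x)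
  (ap : forall x, W x -> aperiodic f x) (eps0 : 0 < eps)
  (fl_free : forall t x, no_break B x (x + t) -> fl t x = x + t)
  (fl_in : forall t x, W x -> 0 <= t < eps -> W (fl t x))
  (flD : forall s t x, 0 <= s -> 0 <= t -> s + t < eps ->
     fl s (fl t x) = fl (s + t) x)
  (fl_neq : forall t x, 0 < t < eps -> fl t x <> x)
  (fl_inj : forall t x y, W x -> W y -> 0 <= t < eps -> fl t x = fl t y -> x = y)
  (fl_f : forall t x, W x -> 0 <= t < eps -> act f (fl t x) = fl t (act f x))
  (fl_h : forall t x, W x -> 0 <= t < eps -> act h (fl t x) = fl t (act h x)).

Lemma fl_fX n t x : W x -> 0 <= t < eps ->
  act (f ^+ n)%g (fl t x) = fl t (act (f ^+ n)%g x).
Proof.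
move=> Wx te; elim: n => [|n ih]; first by rewrite expg0 !act1.
by rewrite !actS ih fl_f// (invariantX Wf).
Qed.

(** The bound [eps / 2] leaves room to compose two displacements within the range of [flD]. *)
Definition fwd n x := exists2 t, 0 < t < eps / 2 & act (f ^+ n)%g x = fl t x.
Definition bwd n x := exists2 t, 0 < t < eps / 2 & x = fl t (act (f ^+ n)%g x).

Let small t : 0 < t < eps / 2 -> 0 <= t < eps.
Proof. by lra. Qed.

Let WX n x : W (act (f ^+ n)%g x) <-> W x.
Proof. exact: invariantX. Qed.

Lemma fwd_f n x : W x -> fwd n (act f x) <-> fwd n x.
Proof.
move=> Wx; split=> -[t te e]; exists t => //.
  by apply: (@act_inj _ f); rewrite fl_f ?small// -e -actS actSr.
by rewrite -fl_f ?small// -e -actS actSr.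
Qed.

Lemma bwd_f n x : W x -> bwd n (act f x) <-> bwd n x.
Proof.
move=> Wx; split=> -[t te e]; exists t => //.
  by apply: (@act_inj _ f); rewrite fl_f ?WX ?small// -actS actSr.
by rewrite {1}e fl_f ?WX ?small// -actS actSr.
Qed.

Lemma fwd_fX m n x : W x -> fwd n (act (f ^+ m)%g x) <-> fwd n x.
Proof.
move=> Wx; elim: m => [|m ih]; first by rewrite expg0 act1.
by rewrite actS fwd_f ?WX.
Qed.

Lemma bwd_fX m n x : W x -> bwd n (act (f ^+ m)%g x) <-> bwd n x.
Proof.
move=> Wx; elim: m => [|m ih]; first by rewrite expg0 act1.
by rewrite actS bwd_f ?WX.
Qed.

Let fXh n x : act (f ^+ n)%g (act h (act (f ^+ n)%g x)) = act h x.
Proof. by rewrite (act_conjX _ _ hf) actXV actVK. Qed.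

(** [h] conjugates [f ^+ n] to its inverse and commutes with the flow. Writing [x] as the image of
    [y] under [f ^+ n] lets [fXh] apply. *)
Lemma fwd_h n x : W x -> fwd n (act h x) <-> bwd n x.
Proof.
move=> Wx; rewrite -(actVK (f ^+ n)%g x).
set y := act _ x; have Wy : W y by rewrite -(WX n) actVK.
rewrite /fwd /bwd fXh; split=> -[t te]; exists t => //.
  by rewrite -fl_fX ?WX ?small//; congr act; apply: (@act_inj _ h);
    rewrite fl_h ?WX ?small.
by rewrite -fl_h ?WX ?small//; congr act; apply: (@act_inj _ (f ^+ n)%g);
  rewrite fl_fX ?WX ?small.
Qed.

Lemma bwd_h n x : W x -> bwd n (act h x) <-> fwd n x.
Proof.
move=> Wx; rewrite -(actVK (f ^+ n)%g x).
set y := act _ x; have Wy : W y by rewrite -(WX n) actVK.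
rewrite /fwd /bwd fXh; split=> -[t te]; exists t => //.
  by rewrite -fl_fX ?WX ?small//; congr act; apply: (@act_inj _ h);
    rewrite fl_h ?WX ?small.
by rewrite -fl_h ?WX ?small//; congr act; apply: (@act_inj _ (f ^+ n)%g);
  rewrite fl_fX ?WX ?small.
Qed.

Lemma fwd_bwd n x : fwd n x -> bwd n x -> False.
Proof.
move=> [t te e] [t' te']; rewrite e flD; [|lra..].
by move/esym; apply: fl_neq; lra.
Qed.

Lemma fwd_fl n u x : W x -> 0 <= u < eps / 2 -> fwd n (fl u x) <-> fwd n x.
Proof.
move=> Wx ue; have ue' : 0 <= u < eps by lra.
split=> -[t te e]; exists t => //.
  apply: (@fl_inj u); rewrite ?WX//; first by apply: fl_in; rewrite ?small.
  by rewrite -fl_fX// e !flD 1?addrC//; lra.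
by rewrite fl_fX// e !flD 1?addrC//; lra.
Qed.

Lemma bwd_fl n u x : W x -> 0 <= u < eps / 2 -> bwd n (fl u x) <-> bwd n x.
Proof.
move=> Wx ue; have ue' : 0 <= u < eps by lra.
split=> -[t te e]; exists t => //.
  apply: (@fl_inj u); rewrite ?WX//; first by apply: fl_in; rewrite ?WX ?small.
  by rewrite {1}e fl_fX// !flD 1?addrC//; lra.
by rewrite {1}e fl_fX// !flD 1?addrC//; lra.
Qed.

Lemma cells : exists s : seq R, forall x y, W x -> W y -> x <= y ->
  no_break s x y -> y - x < eps / 2 /\ fl (y - x) x = y.
Proof.
have [s hs] := grid (divr_gt0 eps0 (ltr0n R 2)).
exists (s ++ B) => x y /W01/andP[x0 _] /W01/andP[_ y1] xy nb.
split; first by apply: hs => //; apply: no_break_sub nb => // p; rewrite mem_cat => ->.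
rewrite fl_free addrC subrK//.
by apply: no_break_sub nb => // p; rewrite mem_cat orbC => ->.
Qed.

(** By pigeonhole two iterates share a cell; they are distinct by aperiodicity, and the flow joins
    the left one to the right one. *)
Lemma returns x : W x -> exists n, (0 < n)%N /\ (fwd n x \/ bwd n x).
Proof.
move=> Wx; have [s hs] := cells.
pose c i := below s (act (f ^+ i)%g x).
have [|i [j [/andP[ij _] cij]]] := @pigeonhole_nat (size s).+1 c.
  by move=> i; rewrite ltnS count_size.
exists (j - i)%N; rewrite subn_gt0; split=> //.
have Wy := iffRL (WX i x) Wx; have Wz := iffRL (WX j x) Wx.
rewrite -(fwd_fX i)// -(bwd_fX i)// /fwd /bwd -actD subnK; last exact: ltnW.
set y := act (f ^+ i)%g x in Wy *; set z := act (f ^+ j)%g x in Wz *.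
have yz : y != z by apply/eqP => /(aperiodic_inj (ap Wx)) e; rewrite e ltnn in ij.
case: (ltgtP y z) yz => // [yz|zy] _.
  have [yze fyz] := hs y z Wy Wz (ltW yz) (no_break_below (ltW yz) cij).
  by left; exists (z - y) => //; rewrite subr_gt0 yz.
have [yze fyz] := hs z y Wz Wy (ltW zy) (no_break_below (ltW zy) (esym cij)).
by right; exists (y - z) => //; rewrite subr_gt0 zy.
Qed.

(** Earlier returns are excluded in both directions whatever [P] is, so that the choices [fwd] and
    [bwd] are complementary on [W]. *)
Definition first_return (P : nat -> R -> Prop) x := exists n, [/\ (0 < n)%N, P n x &
  forall k, (0 < k < n)%N -> ~ fwd k x /\ ~ bwd k x].

Lemma first_return_bwd x : W x ->
  first_return bwd x <-> ~ first_return fwd x.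
Proof.
move=> Wx; split=> [[n [n0 bn hn]] [m [m0 fm hm]]|no].
  case: (ltngtP n m) => [nm|mn|e].
  - by have [|_] := hm n; rewrite ?n0.
  - by have [|h' _] := hn m; rewrite ?m0.
  - by apply: (fwd_bwd fm); rewrite -e.
have [n [n0 hn] min] := ex_first (returns Wx).
have {}min k : (0 < k < n)%N -> ~ fwd k x /\ ~ bwd k x.
  by move=> /andP[k0 kn]; have := min k kn; tauto.
by exists n; split=> //; case: hn => // fn; case: no; exists n.
Qed.

(** [A] is where the first return is ahead. It is piecewise because points of [W] in one cell lie on
    one flow line, along which returns do not change. *)
Lemma orientation_of_flow : exists A : R -> Prop, [/\ pw_set A,
  forall x, A x -> W x, forall x, A (act f x) <-> A x &
  forall x, W x -> (A (act h x) <-> ~ A x)].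
Proof.
exists (fun x => W x /\ first_return fwd x); split.
- have [s hs] := cells.
  have cell : piecewise (fun x y =>
      W x -> W y -> y - x < eps / 2 /\ fl (y - x) x = y).
    by exists s => x y xy nb Wx Wy; apply: hs.
  apply: piecewiseW (piecewiseI pW cell) => x y xy [Wxy c].
  have [Wx|] := pselect (W x); last by tauto.
  have Wy : W y by tauto.
  have [ye yE] := c Wx Wy; have ue : 0 <= y - x < eps / 2 by rewrite subr_ge0 xy.
  have fE n : fwd n y <-> fwd n x by rewrite -{1}yE; apply: fwd_fl.
  have bE n : bwd n y <-> bwd n x by rewrite -{1}yE; apply: bwd_fl.
  split=> -[_ [n [n0 hn min]]]; split=> //; exists n; split=> //; try by apply/fE.
    by move=> k /min; rewrite fE bE.
  by move=> k /min; rewrite fE bE.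
- by move=> x [].
- move=> x; rewrite Wf; split=> -[Wx [n [n0 hn min]]]; split=> //; exists n; split=> //.
  + exact/fwd_f.
  + by move=> k /min; rewrite fwd_f// bwd_f.
  + exact/fwd_f.
  + by move=> k /min; rewrite fwd_f// bwd_f.
- move=> x Wx; rewrite Wh.
  have -> : ~ (W x /\ first_return fwd x) <-> first_return bwd x.
    by rewrite first_return_bwd//; tauto.
  split=> [[_]|] [n [n0 hn min]]; last split=> //; exists n; split=> //.
  + exact/fwd_h.
  + by move=> k /min; rewrite fwd_h// bwd_h//; tauto.
  + exact/fwd_h.
  + by move=> k /min; rewrite fwd_h// bwd_h//; tauto.
Qed.

End Orientation.

(** * Orientation of the part without special points *)

Lemma uniform_bound (T : eqType) (s : seq T) (P : T -> nat -> Prop) :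
  (forall p m n, (m <= n)%N -> P p m -> P p n) ->
  (forall p, p \in s -> exists N, P p N) ->
  exists N, forall p, p \in s -> P p N.
Proof.
move=> mono; elim: s => [|q s ih] h; first by exists 0%N.
have [|N hN] := ih; first by move=> p ps; apply: h; rewrite inE ps orbT.
have [N' hN'] := h q (mem_head _ _).
exists (maxn N N') => p; rewrite inE => /orP[/eqP ->|/hN].
  by apply: mono hN'; rewrite leq_maxr.
by apply: mono; rewrite leq_maxl.
Qed.

Lemma finite_separation (R : realType) (s s' : seq R) : exists2 d : R, 0 < d &
  forall p q, p \in s -> q \in s' -> q != p -> d <= `|q - p|.
Proof.
elim: s => [|p s [d d0 hd]]; first by exists 1.
have [d' d0' hd'] := finite_gap s' p; have [e e0 [ed ed']] := common_lt d0 d0'.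
exists e => // p' q; rewrite inE => /orP[/eqP ->|ps] qs qp.
  by apply: le_trans (ltW ed') _; apply: hd'.
by apply: le_trans (ltW ed) _; apply: hd.
Qed.

Section Orientable.
Context {R : realType} (f h : IET R) (W : R -> Prop).
Context (hf : (h * f = f^-1 * h)%g) (pW : pw_set W)
  (Wf : forall x, W (act f x) <-> W x) (Wh : forall x, W (act h x) <-> W x)
  (ap : forall x, W x -> aperiodic f x) (reg : forall x, W x -> ~ special f x).

Lemma aperiodic01 (g : IET R) x : aperiodic g x -> 0 <= x < 1.
Proof.
move=> apx; apply/negPn/negP => /(act_out g) e.
by apply: (apx 1%N); rewrite // expg1.
Qed.

(** This symmetry makes the gluing commute with [h], which exchanges future and past. *)
Lemma gluedV x b : W x -> glued f x b <-> glued f^-1%g x b.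
Proof. by move=> /reg h'; apply: contrapT => no; apply: h'; exists b. Qed.

Lemma left_inM (g : IET R) b b' : (forall x, W x -> W (act g x)) ->
  left_in W b -> left_germ g b b' -> left_in W b'.
Proof.
move=> Wg [d d0 hd] [d' d0' hd']; have [e e0 [ed ed']] := common_lt d0 d0'.
by exists e => // t te; rewrite -hd'; [apply/Wg/hd|]; lra.
Qed.

(* A point where the gluing is not the obvious one has a break of f in its
   forward orbit and a break of f^-1 in its backward orbit; by aperiodicity two
   given breaks are related by at most one power of f. *)
Lemma finite_jumps : exists s : seq R, forall b, left_in W b ->
  ~ glued f b b -> b \in s.
Proof.
have [s0 h0] := piecewise_cofinite pW.
have [s hs] := glued_self f; have [s' hs'] := glued_self f^-1%g.
have hit (g : IET R) (r : seq R) b :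
    (forall x, (forall i, act (g ^+ i)%g x \notin r) -> glued g x x) ->
    ~ glued g b b -> exists i, act (g ^+ i)%g b \in r.
  move=> hr nb; apply: contrapT => no; apply: nb; apply: hr => i.
  by apply/negP => hi; apply: no; exists i.
pose P (pq : R * R) N := forall i j, aperiodic f pq.2 ->
  act (f ^+ (i + j))%g pq.2 = pq.1 -> (j <= N)%N.
have [||N hN] := @uniform_bound _ [seq (p, q) | p <- s, q <- s'] P.
- by move=> pq m n mn Pm i j apq e; apply: leq_trans (Pm i j apq e) mn.
- move=> [p q] _; rewrite /P /=.
  have [[n [apq e]]|no] := pselect (exists n, aperiodic f q /\ act (f ^+ n)%g q = p).
    exists n => i j _; rewrite -e => /(aperiodic_inj apq) <-; exact: leq_addl.
  by exists 0%N => i j apq e; case: no; exists (i + j)%N.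
(* Here [q] is the break met [j] steps in the past. Outside [s0], a left germ of [W] at [b] puts [b]
   itself in [W]. *)
exists (s0 ++ [seq act (f ^+ j)%g q | j <- iota 0 N.+1, q <- s']) => b lb nb.
rewrite mem_cat; have [//|/h0[d d0 hd]] := boolP (b \in s0).
have Wb : W b.
  have [d' d0' hd'] := lb; have [e e0 [ed ed']] := common_lt d0 d0'.
  by apply: (iffLR (hd (b - e) b _ _ _)); [..|apply: hd']; lra.
have nb' : ~ glued f^-1%g b b by rewrite -gluedV.
have [i hi] := hit _ _ _ hs nb; have [j hj] := hit _ _ _ hs' nb'.
have jN : (j <= N)%N.
  apply: (hN (act (f ^+ i)%g b, act (f^-1 ^+ j)%g b) _ i).
  - by apply/allpairsP; exists (act (f ^+ i)%g b, act (f^-1 ^+ j)%g b).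
  - rewrite /= actXV; apply: ap.
    by rewrite -(invariantX Wf j) actVK.
  - by rewrite /= actXV actD actVK.
apply/orP; right; apply/allpairsP; exists (j, act (f^-1 ^+ j)%g b).
by rewrite mem_iota /= ltnS jN hj actXV actVK.
Qed.

Lemma orientation : exists A : R -> Prop, [/\ pw_set A,
  forall x, A x -> W x, forall x, A (act f x) <-> A x &
  forall x, W x -> (A (act h x) <-> ~ A x)].
Proof.
have /choice[gl hgl] : forall b, exists a, left_in W b -> W a /\ glued f a b.
  move=> b.
  have [lb|nb] := pselect (left_in W b); last by exists 0.
  by have [a Wa ga] := glued_ex pW Wf ap lb; exists a.
have gl_in b : left_in W b -> W (gl b) by move=> /hgl[].
have gl_glued b : left_in W b -> glued f (gl b) b by move=> /hgl[].
have [s hs] := finite_jumps.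
pose B := [seq b <- s | `[< left_in W b /\ gl b != b >]].
have gl_B b : left_in W b -> gl b != b -> b \in B.
  move=> lb gb; rewrite mem_filter; apply/andP; split; first exact/asboolP.
  by apply: hs => // /(glued_uniql (gl_glued b lb)) e; rewrite e eqxx in gb.
have B_gl b : b \in B -> left_in W b /\ gl b != b.
  by rewrite mem_filter => /andP[/asboolP].
have gl_inj b b' : left_in W b -> left_in W b' -> gl b = gl b' -> b = b'.
  move=> /gl_glued gb /gl_glued gb' e; rewrite e in gb.
  exact: glued_uniqr gb gb'.
(* Separating the breaks together with their glued images yields the three gap conditions at
   once. *)
have [eps eps0 sep] := finite_separation (B ++ map gl B) (B ++ map gl B).
have inB b : b \in B -> b \in B ++ map gl B by rewrite mem_cat => ->.
have ingl b : b \in B -> gl b \in B ++ map gl B.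
  by move=> bB; rewrite mem_cat map_f ?orbT.
have gapBB b b' : b \in B -> b' \in B -> b' != b -> eps <= `|b' - b|.
  by move=> /inB bB /inB; apply: sep.
have gapBg b b' : b \in B -> b' \in B -> b' != gl b -> eps <= `|b' - gl b|.
  by move=> /ingl bB /inB; apply: sep.
have gapgg b b' : b \in B -> b' \in B -> gl b' != gl b -> eps <= `|gl b' - gl b|.
  by move=> /ingl bB /ingl; apply: sep.
have Wf' x : W x -> W (act f x) by rewrite Wf.
have Wh' x : W x -> W (act h x) by rewrite Wh.
have gl_f b b' : left_in W b -> left_germ f b b' -> gl b' = act f (gl b).
  move=> lb fb; apply: glued_uniql (gl_glued _ (left_inM Wf' lb fb)) _.
  by apply: glued_conj fb (gl_glued _ lb) => //; apply: ap; apply: gl_in.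
(* [h] carries gluing along [f^-1] to gluing along [f], so the gluing at [b] is first read in the
   past through [gluedV]. *)
have gl_h b b' : left_in W b -> left_germ h b b' -> gl b' = act h (gl b).
  move=> lb hb; apply: glued_uniql (gl_glued _ (left_inM Wh' lb hb)) _.
  have hfV : (h * f^-1 = f * h)%g by rewrite (conjV hf) invgK.
  have := iffLR (gluedV b (gl_in _ lb)) (gl_glued _ lb).
  by apply: glued_conj hfV _ hb; apply: aperiodicV; apply: ap; apply: gl_in.
apply: (@orientation_of_flow _ f h W (flow gl B) B eps) => //.
- by move=> x /ap; apply: aperiodic01.
- by move=> t x nb; rewrite flow_free.
- by move=> t x; apply: flow_in.
- by move=> u t x; apply: flowD.
- by move=> t x; apply: (flow_neq B_gl gapBB gapBg).
- by move=> t x y; apply: flow_inj.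
- by move=> t x; apply: flow_comm.
- by move=> t x; apply: flow_comm.
Qed.

End Orientable.

(** * Periodic points *)

Section Periodic.
Context {R : realType} (f : IET R).
Implicit Types (x y z u : R).

Lemma last_below (s : seq R) x : (exists2 p, p \in s & p <= x) ->
  exists u, [/\ u \in s, u <= x & forall p, p \in s -> p <= x -> p <= u].
Proof.
elim: s => [[p //]|q s ih] [p ps px].
have [ex|no] := pselect (exists2 p, p \in s & p <= x).
  have [u [us ux um]] := ih ex; have [qx|xq] := leP q x; last first.
    exists u; split=> //; first by rewrite inE us orbT.
    move=> r; rewrite inE => /orP[/eqP -> qx|rs rx]; last exact: um.
    by have := lt_le_trans xq qx; rewrite ltxx.
  have [qu|uq] := leP q u.
    exists u; split=> //; first by rewrite inE us orbT.
    by move=> r; rewrite inE => /orP[/eqP -> //|]; apply: um.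
  exists q; split=> //; first by rewrite mem_head.
  move=> r; rewrite inE => /orP[/eqP -> //|rs rx].
  by apply: le_trans (um r rs rx) (ltW uq).
exists p; split=> // r; move: ps; rewrite !inE => /orP[/eqP pq|ps].
  by move=> /orP[/eqP ->|rs rx]; [rewrite pq|case: no; exists r].
by case: no; exists p.
Qed.

Lemma actX_fixed m n x : act (f ^+ m)%g x = x -> (m %| n)%N ->
  act (f ^+ n)%g x = x.
Proof.
move=> fx /dvdnP[k ->]; elim: k => [|k ih]; first by rewrite mul0n expg0 act1.
by rewrite mulSn actD ih.
Qed.

Lemma actX_fixed_shift m n x : act (f ^+ m)%g x = x ->
  act (f ^+ m)%g (act (f ^+ n)%g x) = act (f ^+ n)%g x.
Proof. by move=> fx; rewrite -actD addnC actD fx. Qed.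

(* Sliding a periodic point to the left until some iterate meets a break
   shows that its period is that of a break. *)
Lemma periods_bounded : exists2 q, (0 < q)%N & forall x n, (0 < n)%N ->
  act (f ^+ n)%g x = x -> act (f ^+ q)%g x = x.
Proof.
have [s hs] := act_trans f.
(* The clause [m <= n] allows [slide] to be used for the exponent [m]. *)
pose P (d : R) N := forall n, (0 < n)%N -> act (f ^+ n)%g d = d ->
  exists m, [/\ (0 < m)%N, (m <= N)%N, (m <= n)%N & act (f ^+ m)%g d = d].
have [||N hN] := @uniform_bound _ (0 :: s) P.
- move=> d m n mn Pm k k0 /(Pm k k0)[l [l0 lm lk e]].
  by exists l; split=> //; apply: leq_trans mn.
- move=> d _; have [ex|no] := pselect (exists n, (0 < n)%N /\ act (f ^+ n)%g d = d).
    have [m [m0 e] min] := ex_first ex; exists m => n n0 en; exists m; split=> //.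
    by rewrite leqNgt; apply/negP => /min; case.
  by exists 0%N => n n0 e; case: no; exists n.
exists N`!; first exact: fact_gt0.
move=> x n n0 e; have [x01|x01] := boolP (0 <= x < 1); last by rewrite act_out.
suff [m [m0 mN em]] : exists m, [/\ (0 < m)%N, (m <= N)%N & act (f ^+ m)%g x = x].
  by apply: actX_fixed em _; apply: dvdn_fact; rewrite m0.
(* These points reach a break or 0 in fewer than [n] steps. If [u] is the last of them up to [x],
   the first [n] iterates move [[u, x]] rigidly; including 0 ensures that [u] exists. *)
pose E := [seq act (f ^+ i)^-1%g d | i <- iota 0 n, d <- 0 :: s].
have inE i d : (i < n)%N -> d \in 0 :: s -> act (f ^+ i)^-1%g d \in E.
  move=> i_n ds; apply/allpairsP; exists (i, d).
  by rewrite mem_iota.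
have [|u [uE ux um]] := @last_below E x.
  exists 0; last by lra.
  by have := inE 0%N 0 n0 (mem_head _ _); rewrite expg0 invg1 act1.
have slide i : (i <= n)%N -> forall z, u <= z -> z <= x ->
    act (f ^+ i)%g z = act (f ^+ i)%g u + (z - u).
  elim: i => [|i ih] i_n z uz zx; first by rewrite expg0 !act1; lra.
  have ih' := ih (ltnW i_n); rewrite !actS.
  rewrite (hs (act (f ^+ i)%g u) (act (f ^+ i)%g z)) ?(ih' z uz zx); [lra|lra|].
  move=> d ds; apply/negP => /andP[ud dz].
  have zE : act (f ^+ i)%g (u + (d - act (f ^+ i)%g u)) = d by rewrite ih'; lra.
  have := inE i d i_n; rewrite -{2}zE actK in_cons ds orbT => /(_ isT) h.
  by have := um _ h; lra.
have fu : act (f ^+ n)%g u = u by have := slide n (leqnn n) x ux (lexx x); rewrite e; lra.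
have /allpairsP[[j d] /= [_ ds uE']] := uE.
have dE : d = act (f ^+ j)%g u by rewrite uE' actVK.
have [|m [m0 mN mn em]] := hN d ds n n0.
  by rewrite dE actX_fixed_shift.
exists m; split=> //; rewrite slide//.
have -> : act (f ^+ m)%g u = u; last by lra.
apply: (@act_inj _ (f ^+ j)%g).
by rewrite -actD addnC actD -dE.
Qed.

(** If the [i]-th iterate of [x] is the least point of its orbit, reflecting the orbit about that
    point sends [x] to its [(i + i)]-th iterate. *)
Lemma periodic_reversal q : (0 < q)%N -> exists phi : R -> R,
  pw_trans phi /\ forall x, act (f ^+ q)%g x = x ->
  [/\ exists m, phi x = act (f ^+ m)%g x, phi (phi x) = x &
      phi (act f x) = act f^-1%g (phi x)].
Proof.
move=> q0; pose P x := act (f ^+ q)%g x = x.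
pose least x := forall k, (k < q)%N -> x <= act (f ^+ k)%g x.
have fmod x m : P x -> act (f ^+ m)%g x = act (f ^+ (m %% q))%g x.
  move=> Px; rewrite {1}(divn_eq m q) addnC actD.
  by rewrite (actX_fixed Px (dvdn_mull _ (dvdnn q))).
have leastE x i j : P x -> least (act (f ^+ i)%g x) -> least (act (f ^+ j)%g x) ->
    act (f ^+ i)%g x = act (f ^+ j)%g x.
  have aux k l : P x -> least (act (f ^+ k)%g x) ->
      act (f ^+ k)%g x <= act (f ^+ l)%g x.
    move=> Px mk; have := mk ((l + k * q.-1) %% q)%N; rewrite ltn_mod q0 => /(_ isT).
    have Pk : P (act (f ^+ k)%g x) by apply: actX_fixed_shift.
    rewrite -fmod// -actD -addnA -mulnSr prednK// actD.
    by rewrite (actX_fixed Px (dvdn_mull _ (dvdnn q))).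
  by move=> Px mi mj; apply/le_anti; rewrite !aux//.
have ex_least x : P x -> exists2 i, (i < q)%N & least (act (f ^+ i)%g x).
  move=> Px; pose F (i : 'I_q) := act (f ^+ i)%g x.
  have [i _ hi] := arg_minP (P := xpredT) (i0 := Ordinal q0) F isT.
  exists i => // k kq; rewrite -actD (fmod x (k + i)%N)//.
  exact: (hi (Ordinal (ltn_pmod (k + i) q0)) isT).
pose rel x y := (P x -> exists i, [/\ (i < q)%N, least (act (f ^+ i)%g x) &
  y = act (f ^+ (i + i))%g x]) /\ (~ P x -> y = x).
have /choice[phi hphi] : forall x, exists y, rel x y.
  move=> x; have [Px|nP] := pselect (P x); last by exists x; split.
  by have [i iq li] := ex_least x Px; exists (act (f ^+ (i + i))%g x);
    split=> // _; exists i.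
(* The least point is unique, so any exponent reaching it will do. No bound by [q] is imposed, which
   permits [i * q.-1] and [j.+1] below. *)
have phiE x i : P x -> least (act (f ^+ i)%g x) -> phi x = act (f ^+ (i + i))%g x.
  move=> Px li; have [/(_ Px)[j [_ lj ->]] _] := hphi x.
  have e := leastE x i j Px li lj.
  by rewrite !actD e -[RHS]actD addnC actD e.
exists phi; split.
  (* The index [q] stands for the complement of [P], where [phi] is the identity. *)
  pose A i x := if (i < q)%N then P x /\ least (act (f ^+ i)%g x) else ~ P x.
  pose psi i := if (i < q)%N then act (f ^+ (i + i))%g else act 1%g.
  have pP : pw_set P.
    by apply: (eq_pw_set _ (pw_set_eq (f ^+ q)%g 1%g)) => x; rewrite act1.
  apply: (@pw_trans_glue _ q.+1 A psi) => [i _|i _|i x _|x].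
  - rewrite /A; case: (i < q)%N; last exact: pw_setC.
    apply: pw_setI => //; apply: pw_set_forall => k _.
    apply: (eq_pw_set _ (pw_set_le (f ^+ i)%g (f ^+ (k + i))%g)) => x.
    by rewrite actD.
  - by rewrite /psi; case: ifP => _; apply: act_trans.
  - rewrite /A /psi; case: ifP => _; first by case; apply: phiE.
    by rewrite act1; case: (hphi x).
  - have [Px|nP] := pselect (P x).
      by have [i iq li] := ex_least x Px; exists i; [rewrite ltnS ltnW|rewrite /A iq].
    by exists q => //; rewrite /A ltnn.
move=> x Px; have [i iq li] := ex_least x Px.
have phix := phiE x i Px li; split; first by exists (i + i)%N.
  have Py : P (phi x) by rewrite phix; apply: actX_fixed_shift.
  (* [i * q.-1] represents [-i] modulo [q], and brings [phi x] back to the least point. *)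
  have e : act (f ^+ (i * q.-1))%g (phi x) = act (f ^+ i)%g x.
    rewrite phix -actD addnA -mulnSr prednK// addnC actD.
    by rewrite (actX_fixed Px (dvdn_mull _ (dvdnn q))).
  rewrite (phiE _ (i * q.-1)%N Py); last by rewrite e.
  rewrite actD e -actD -mulnSr prednK//.
  exact: actX_fixed Px (dvdn_mull _ (dvdnn q)).
have Pfx : P (act f x) by rewrite /P -actSr actS Px.
apply: (@act_inj _ f); rewrite actVK.
have [j jq lj] := ex_least _ Pfx.
rewrite (phiE _ j Pfx lj) (phiE x j.+1 Px); last by rewrite actSr.
by rewrite -actSr -actS addSn addnS.
Qed.

End Periodic.

(** * Points returning to their f-orbit under h *)

Section Cover.
Context {R : realType} (f h : IET R) (hf : (h * f = f^-1 * h)%g).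
Implicit Types (x y z u : R).

Let hfV : (h * f^-1 = f * h)%g.
Proof. by rewrite (conjV hf) invgK. Qed.

Lemma reverser_even n : (h ^+ n.*2 * f = f * h ^+ n.*2)%g.
Proof.
elim: n => [|n ih]; first by rewrite !expg0 mulg1 mul1g.
rewrite doubleS !expgS -!mulgA ih [in LHS](mulgA h f) hf -(mulgA f^-1%g).
by rewrite !mulgA hfV.
Qed.

Lemma reverser_odd n : (h ^+ n.*2.+1 * f = f^-1 * h ^+ n.*2.+1)%g.
Proof. by rewrite expgS -mulgA reverser_even mulgA hf mulgA. Qed.

Lemma act_even n x : act (h ^+ n.*2)%g (act f x) = act f (act (h ^+ n.*2)%g x).
Proof. exact: act_conj (reverser_even n). Qed.

Lemma act_evenX n k x :
  act (h ^+ n.*2)%g (act (f ^+ k)%g x) = act (f ^+ k)%g (act (h ^+ n.*2)%g x).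
Proof. exact: act_conjX (reverser_even n). Qed.

Lemma act_oddX n k x : act (h ^+ n.*2.+1)%g (act (f ^+ k)%g x) =
  act (f ^+ k)^-1%g (act (h ^+ n.*2.+1)%g x).
Proof. by rewrite (act_conjX _ _ (reverser_odd n)) actXV. Qed.

Lemma act_hX k x : act (f ^+ k)%g (act h (act (f ^+ k)%g x)) = act h x.
Proof. by rewrite (act_conjX _ _ hf) actXV actVK. Qed.

(** Even powers of [h] commute with [f], whence the [f]-invariance of this set and the next two; the
    bound [N] makes them piecewise. *)
Definition h_periodic N x := exists2 n, (n < N)%N & act (h ^+ n.+1.*2)%g x = x.

Definition h_forward N x := exists2 n, (n < N)%N & exists2 k, (k < N)%N &
  act (h ^+ n.+1.*2)%g x = act (f ^+ k.+1)%g x.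

Definition h_backward N x := exists2 n, (n < N)%N & exists2 k, (k < N)%N &
  act (f ^+ k.+1)%g (act (h ^+ n.+1.*2)%g x) = x.

Definition h_returns N x := h_periodic N x \/ h_forward N x \/ h_backward N x.

Lemma pw_h_periodic N : pw_set (h_periodic N).
Proof.
apply: pw_set_exists => n _.
by apply: (eq_pw_set _ (pw_set_eq (h ^+ n.+1.*2)%g 1%g)) => x; rewrite act1.
Qed.

Lemma pw_h_forward N : pw_set (h_forward N).
Proof. by apply: pw_set_exists => n _; apply: pw_set_exists => k _; apply: pw_set_eq. Qed.

Lemma pw_h_backward N : pw_set (h_backward N).
Proof.
apply: pw_set_exists => n _; apply: pw_set_exists => k _.
apply: (eq_pw_set _ (pw_set_eq (f ^+ k.+1 * h ^+ n.+1.*2)%g 1%g)) => x.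
by rewrite act1 actM.
Qed.

Lemma h_returns_le m n x : (m <= n)%N -> h_returns m x -> h_returns n x.
Proof.
move=> mn [[i im e]|[[i im [k km e]]|[i im [k km e]]]]; [left|right; left|right; right];
  exists i => //; try exists k => //; by apply: leq_trans mn.
Qed.

Lemma h_periodic_f N x : h_periodic N (act f x) <-> h_periodic N x.
Proof.
split=> -[n nN e]; exists n => //; last by rewrite act_even e.
by apply: (@act_inj _ f); rewrite -act_even.
Qed.

Lemma h_forward_f N x : h_forward N (act f x) <-> h_forward N x.
Proof.
split=> -[n nN [k kN e]]; exists n => //; exists k => //.
  by apply: (@act_inj _ f); rewrite -act_even e -actSr -actS.
by rewrite act_even e -actSr -actS.
Qed.

Lemma h_backward_f N x : h_backward N (act f x) <-> h_backward N x.
Proof.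
split=> -[n nN [k kN e]]; exists n => //; exists k => //.
  by apply: (@act_inj _ f); rewrite -[RHS]e act_even -actSr -actS.
by rewrite act_even -actSr actS e.
Qed.

Lemma h_periodic_h N x : h_periodic N (act h x) <-> h_periodic N x.
Proof.
split=> -[n nN e]; exists n => //; last by rewrite -actSr actS e.
by apply: (@act_inj _ h); rewrite -actS actSr.
Qed.

Lemma h_forward_h N x : h_forward N (act h x) <-> h_backward N x.
Proof.
split=> -[n nN [k kN e]]; exists n => //; exists k => //.
  apply: (@act_inj _ h); rewrite (act_conjX _ _ hf) -actS (actSr h) e.
  by rewrite actXV actK.
by rewrite -[in RHS]e act_hX -actSr actS.
Qed.

Lemma h_backward_h N x : h_backward N (act h x) <-> h_forward N x.
Proof.
split=> -[n nN [k kN e]]; exists n => //; exists k => //.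
  apply: (@act_inj _ h); rewrite -actS (actSr h) (act_conjX _ _ hf) actXV.
  by rewrite -[in RHS]e actK.
by rewrite -(actSr h) (actS h) e act_hX.
Qed.

Lemma h_returns_f N x : h_returns N (act f x) <-> h_returns N x.
Proof. by rewrite /h_returns h_periodic_f h_forward_f h_backward_f. Qed.

Lemma h_returns_h N x : h_returns N (act h x) <-> h_returns N x.
Proof. by rewrite /h_returns h_periodic_h h_forward_h h_backward_h; tauto. Qed.

Lemma h_periodic_fact N x : h_periodic N x -> act (h ^+ N`!.*2)%g x = x.
Proof.
move=> [n nN e]; apply: actX_fixed e _.
by rewrite -!muln2 dvdn_mul// dvdn_fact.
Qed.

(** At a common power of [h], the two returns would equate a positive and a negative power of [f] at
    [x]. *)
Lemma h_forward_backward N x : aperiodic f x ->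
  h_forward N x -> h_backward N x -> False.
Proof.
move=> ap [m _ [k _ e]] [n _ [l _ e']].
have fwd i : act (h ^+ (i * m.+1).*2)%g x = act (f ^+ (i * k.+1))%g x.
  elim: i => [|i ih]; first by rewrite !mul0n.
  by rewrite !mulSn doubleD actD ih act_evenX e -actD addnC.
have bwd i : act (f ^+ (i * l.+1))%g (act (h ^+ (i * n.+1).*2)%g x) = x.
  elim: i => [|i ih]; first by rewrite !mul0n !expg0 !act1.
  by rewrite !mulSn doubleD (addnC n.+1.*2) (addnC l.+1) !actD -act_evenX e'.
have pos : (0 < m.+1 * l.+1 + n.+1 * k.+1)%N by rewrite addn_gt0 muln_gt0.
by case: (ap _ pos); rewrite actD -fwd (mulnC n.+1) bwd.
Qed.

(** For odd [n], [h ^+ n] inverts [f], so using the relation twice cancels the powers of [f] and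
    [h ^+ (n + n)] fixes [x]. For even [n], comparing [i] and [j] decides the kind of return. *)
Lemma returns_of_orbit x n i j : (0 < n)%N ->
  act (f ^+ i)%g x = act (f ^+ j)%g (act (h ^+ n)%g x) -> exists N, h_returns N x.
Proof.
move=> n0; have [no|ne] := boolP (odd n).
  move=> e; have nE : n = n./2.*2.+1 by rewrite -[LHS]odd_double_half no.
  exists n; left; exists n.-1; rewrite prednK// -addnn actD.
  apply: (@act_inj _ (f ^+ i)%g).
  have := congr1 (act (h ^+ n)%g) e; rewrite nE !act_oddX -nE.
  by move/(canRL (actVK _)) => e'; rewrite e [in RHS]e' -[RHS]actD addnC actD actVK.
have nE : n = n./2.*2 by rewrite -[LHS]odd_double_half (negbTE ne).
have m0 : (0 < n./2)%N by rewrite -double_gt0 -nE.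
rewrite nE -act_evenX -(prednK m0); set m := n./2.-1.
case: (ltngtP i j) => [ij|ji|->].
- rewrite -(subnK (ltnW ij)) => e; exists (m + j)%N.+1; right; right.
  exists m; first by rewrite ltnS leq_addr.
  exists (j - i).-1; first by lia.
  rewrite prednK ?subn_gt0// -act_evenX; apply: (@act_inj _ (f ^+ i)%g).
  by rewrite -act_evenX -actD addnC -e.
- rewrite -(subnK (ltnW ji)) => e; exists (m + i)%N.+1; right; left.
  exists m; first by rewrite ltnS leq_addr.
  exists (i - j).-1; first by lia.
  rewrite prednK ?subn_gt0//; apply: (@act_inj _ (f ^+ j)%g).
  by rewrite -act_evenX -actD addnC -e.
- by rewrite act_evenX => /act_inj e; exists m.+1; left; exists m.
Qed.

(** All [h]-iterates of [x] are special, so their [f]-orbits meet one finite set, and by pigeonhole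
    two of them share an [f]-orbit. *)
Lemma special_returns x : aperiodic f x -> special f x ->
  exists N, h_returns N x.
Proof.
move=> ap sp; have [s hs] := special_orbit f.
have hX i : aperiodic f (act (h ^+ i)%g x) /\ special f (act (h ^+ i)%g x).
  elim: i => [|i [api spi]]; first by rewrite expg0 act1.
  rewrite actS; split; last by apply/specialV; apply: special_conj hf _ _.
  by have := aperiodicV (aperiodic_conj hf api); rewrite invgK.
have hit i : exists d, d \in s /\ exists k l,
    act (f ^+ k)%g (act (h ^+ i)%g x) = act (f ^+ l)%g d.
  have [k [kd|kd]] := hs _ (proj2 (hX i)).
    by exists (act (f ^+ k)%g (act (h ^+ i)%g x)); split=> //; exists k, 0%N;
      rewrite expg0 act1.
  exists (act (f^-1 ^+ k)%g (act (h ^+ i)%g x)); split=> //; exists 0%N, k.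
  by rewrite expg0 act1 actXV actVK.
have /choice[d hd] := hit.
have [|i [j [/andP[ij _] dij]]] := @pigeonhole_nat (size s) (fun i => index (d i) s).
  by move=> i; rewrite index_mem; case: (hd i).
have dE : d i = d j.
  by rewrite -[LHS](nth_index 0 (proj1 (hd i))) dij nth_index//; case: (hd j).
have [_ [k [l e]]] := hd i; have [_ [k' [l' e']]] := hd j.
suff [N hN] : exists N, h_returns N (act (h ^+ i)%g x).
  exists N; move: hN; elim: (i) => [|m ih]; first by rewrite expg0 act1.
  by rewrite actS h_returns_h.
apply: (@returns_of_orbit _ (j - i)%N (l' + k)%N (l + k')%N); first by rewrite subn_gt0.
rewrite -actD subnK; last exact: ltnW.
by rewrite !actD e e' dE -!actD addnC.
Qed.

(** It suffices to bound the exponents on the finite set met by all special orbits, since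
    [h_returns] is constant along [f]-orbits. *)
Lemma special_returns_uniform :
  exists N, forall x, aperiodic f x -> special f x -> h_returns N x.
Proof.
have [s hs] := special_orbit f.
pose P (d : R) N := aperiodic f d -> special f d -> h_returns N d.
have [||N hN] := @uniform_bound _ s P.
- by move=> d m n mn Pm api spd; apply: h_returns_le mn (Pm api spd).
- move=> d _; have [[api spd]|no] := pselect (aperiodic f d /\ special f d).
    by have [N hN] := special_returns api spd; exists N.
  by exists 0%N => api spd; case: no.
exists N => x apx spx.
have comm k : (f ^+ k * f = f * f ^+ k)%g by rewrite -expgS expgSr.
have comm' k : (f^-1 ^+ k * f = f * f^-1 ^+ k)%g.
  by apply: esym; rewrite (conjX k (k := f) (g := f^-1%g) (g' := f^-1%g)) // mulVg mulgV.
have retX k y : h_returns N (act (f ^+ k)%g y) <-> h_returns N y.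
  exact: invariantX (h_returns_f N) k y.
have [k [kd|kd]] := hs x spx.
  apply/(retX k); apply: hN kd _ _; first exact: aperiodic_conj (comm k) apx.
  exact: special_conj (comm k) apx spx.
have : h_returns N (act (f^-1 ^+ k)%g x).
  apply: hN kd _ _; first exact: aperiodic_conj (comm' k) apx.
  exact: special_conj (comm' k) apx spx.
by rewrite -(retX k) actXV actVK.
Qed.

End Cover.

(** * Construction of the reversing map *)

Lemma pw_trans_if (R : realType) (A : R -> Prop) (phi psi : R -> R) :
  pw_set A -> pw_trans phi -> pw_trans psi ->
  pw_trans (fun x => if pselect (A x) then phi x else psi x).
Proof.
move=> pA hphi hpsi; apply: piecewiseW (piecewiseI pA (piecewiseI hphi hpsi)).
move=> x y _ [Axy [ephi epsi]].
by case: pselect => Ay; case: pselect => Ax //; exfalso; tauto.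
Qed.

(** The order divides [2 ^ a], hence is 1, 2 or a multiple of 4. *)
Lemma order_of_expg2 (G : groupType) (g : G) a : (g ^+ (2 ^ a) = 1)%g ->
  finite_order g /\ (involution g \/ exists n, has_order g n /\ (4 %| n)%N).
Proof.
move=> ga; have [|m [m0 gm] min] := @ex_first (fun m => (0 < m)%N /\ (g ^+ m = 1)%g).
  by exists (2 ^ a)%N; rewrite expn_gt0.
have gord : has_order g m.
  by split=> // k k0 gk; rewrite leqNgt; apply/negP => /min; apply.
split; first by exists m.
have : (m %| 2 ^ a)%N.
  rewrite /dvdn; apply/negPn/negP; rewrite -lt0n => r0.
  apply: (min (2 ^ a %% m)%N); first exact: ltn_pmod.
  split=> //; move: ga; rewrite {1}(divn_eq (2 ^ a) m) expgnDr mulnC expgnA gm.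
  by rewrite expg1n mul1g.
move=> /(dvdn_pfactor _ _ (isT : prime 2))[[|[|b]] _ mE].
- by left; rewrite /involution -(expg1n _ 2) -[in RHS]gm mE expn0 expg1.
- by left; rewrite /involution -[RHS]gm mE.
- by right; exists m; split=> //; rewrite mE !expnS mulnA dvdn_mulr.
Qed.

Section Assembly.
Context {R : realType} (f h : IET R) (hf : (h * f = f^-1 * h)%g).
Implicit Types (x : R).

Lemma periodic_h q x : act (f ^+ q)%g (act h x) = act h x <-> act (f ^+ q)%g x = x.
Proof.
have hX := act_hX hf q x; split=> e; last by rewrite -[RHS]hX e.
by apply: (@act_inj _ h); apply: (@act_inj _ (f ^+ q)%g); rewrite hX e.
Qed.

(** [S] is given on [W] by [orientation], and elsewhere by the sign of the return, unambiguous by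
    aperiodicity. *)
Lemma signed_set q N : (forall x, act (f ^+ q)%g x <> x -> aperiodic f x) ->
  (forall x, aperiodic f x -> special f x -> h_returns f h N x) ->
  exists S : R -> Prop, [/\ pw_set S, forall x, S (act f x) <-> S x &
    forall x, act (f ^+ q)%g x <> x -> ~ h_periodic h N x ->
      (S (act h x) <-> ~ S x)].
Proof.
move=> hap hN; pose P x := act (f ^+ q)%g x = x.
pose W x := ~ P x /\ ~ h_returns f h N x.
have Pf x : P (act f x) <-> P x.
  rewrite /P -actSr actS; split=> [/act_inj//|->//].
have pP : pw_set P.
  by apply: (eq_pw_set _ (pw_set_eq (f ^+ q)%g 1%g)) => x; rewrite act1.
have pW : pw_set W.
  apply: pw_setI; first exact: pw_setC.
  apply: pw_setC; apply: pw_setU; first exact: pw_h_periodic.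
  by apply: pw_setU; [apply: pw_h_forward|apply: pw_h_backward].
have [||||A [pA AW Af Ah]] := @orientation _ f h W hf pW.
- by move=> x; rewrite /W Pf (h_returns_f hf).
- by move=> x; rewrite /W (h_returns_h hf) /P periodic_h.
- by move=> x [/hap].
- by move=> x [nP nr] /hN h'; apply: nr; apply: h'; apply: hap.
exists (fun x => ~ P x /\ (h_forward f h N x \/ A x)); split.
- apply: pw_setI; first exact: pw_setC.
  by apply: pw_setU => //; apply: pw_h_forward.
- by move=> x; rewrite Pf Af (h_forward_f hf).
move=> x nP nper; rewrite (h_forward_h hf).
have dis := @h_forward_backward _ f h hf N x (hap x nP).
have AWx := AW x; have AWh := AW (act h x).
have Whx : W (act h x) <-> W x by rewrite /W (h_returns_h hf) /P periodic_h.
have Phx : P (act h x) <-> P x by apply: periodic_h.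
have Ahx := Ah x.
have [Wx|nW] := pselect (W x).
  have [_] := Wx; rewrite /h_returns => nr; have := Ahx Wx.
  by rewrite /P in nP Phx *; tauto.
have : h_forward f h N x \/ h_backward f h N x.
  apply: contrapT => no; apply: nW; split=> //; rewrite /h_returns; tauto.
by rewrite /P in nP Phx *; tauto.
Qed.

Lemma reverser_expg2 : exists g : IET R, (g * f = f^-1 * g)%g /\
  exists a, (g ^+ (2 ^ a) = 1)%g.
Proof.
have [q q0 hq] := periods_bounded f.
have hap x : act (f ^+ q)%g x <> x -> aperiodic f x.
  by move=> nx n n0 e; apply: nx; apply: hq n0 e.
have [N hN] := special_returns_uniform hf.
have [S [pS Sf Sh]] := signed_set hap hN.
have [rho [prho hrho]] := periodic_reversal f q0.
have e0 : (0 < N`!.*2)%N by rewrite double_gt0 fact_gt0.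
(* The odd part [r] is split off: [h ^+ r] still reverses [f], and its power of exponent [2 ^ a] is
   trivial at the [h_periodic] points. *)
have [r cr eE] := pfactor_coprime (isT : prime 2) e0.
set a := logn 2 _ in eE.
(* Then [2 ^ a] is even, as required where [phi] is an involution. *)
have a0 : (0 < a)%N.
  by rewrite logn_gt0 mem_primes /= e0 -muln2 dvdn_mull.
have rE : r = r./2.*2.+1.
  by rewrite -[LHS]odd_double_half; move: cr; rewrite coprime2n => ->.
pose P x := act (f ^+ q)%g x = x.
pose phi x := if pselect (P x) then rho x else
  if pselect (h_periodic h N x) then act (h ^+ r)%g x else
  if pselect (S x) then act h x else act h^-1%g x.
have pP : pw_set P.
  by apply: (eq_pw_set _ (pw_set_eq (f ^+ q)%g 1%g)) => x; rewrite act1.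
have pphi : pw_trans phi.
  apply: pw_trans_if => //; apply: pw_trans_if; first exact: pw_h_periodic.
    exact: act_trans.
  by apply: pw_trans_if => //; apply: act_trans.
have Pf x : P (act f x) <-> P x.
  rewrite /P -actSr actS; split=> [/act_inj//|->//].
have Ph x : P (act h x) <-> P x by apply: periodic_h.
have Hf x := h_periodic_f hf N x; have Hh x := h_periodic_h h N x.
have phiP x : P x -> phi x = rho x by move=> Px; rewrite /phi; case: pselect.
have phiH x : ~ P x -> h_periodic h N x -> phi x = act (h ^+ r)%g x.
  by move=> nP Hx; rewrite /phi; do 2!case: pselect => //.
have phiS x : ~ P x -> ~ h_periodic h N x -> S x -> phi x = act h x.
  by move=> nP Hx Sx; rewrite /phi; do 3!case: pselect => //.
have phiN x : ~ P x -> ~ h_periodic h N x -> ~ S x -> phi x = act h^-1%g x.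
  by move=> nP Hx Sx; rewrite /phi; do 3!case: pselect => //.
have PhX n x : P (act (h ^+ n)%g x) <-> P x by apply: invariantX.
have HhX n x : h_periodic h N (act (h ^+ n)%g x) <-> h_periodic h N x.
  by apply: invariantX.
have hVE x : exists y, x = act h y by exists (act h^-1%g x); rewrite actVK.
have conj x : phi (act f x) = act f^-1%g (phi x).
  have [Px|nP] := pselect (P x).
    by rewrite !phiP ?Pf//; have [] := hrho x Px.
  have nPf : ~ P (act f x) by rewrite Pf.
  have [Hx|nH] := pselect (h_periodic h N x).
    rewrite !phiH ?Hf// rE.
    exact: act_conj (reverser_odd hf _).
  have nHf : ~ h_periodic h N (act f x) by rewrite Hf.
  have [Sx|nS] := pselect (S x).
    by rewrite !phiS ?Sf//; apply: act_conj.
  rewrite !phiN ?Sf//; apply: (@act_inj _ h).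
  by rewrite actVK (act_conj _ (conjV hf)) invgK actVK.
have inv x : ~ h_periodic h N x \/ P x -> phi (phi x) = x.
  have [Px _|nP [nH|//]] := pselect (P x).
    rewrite (phiP x)//; have [[m e] rr _] := hrho x Px.
    by rewrite phiP// e /P actX_fixed_shift.
  have [Sx|nS] := pselect (S x).
    by rewrite (phiS x)// phiN ?actK ?Ph ?Hh ?Sh//; tauto.
  (* [Sh] concerns images under [h], so [x] is written as one. *)
  have [y yE] := hVE x; move: nP nH nS; rewrite yE Ph Hh => nP nH nS.
  rewrite (phiN (act h y)) ?Ph ?Hh// actK phiS//.
  by apply: contrapT; rewrite -Sh.
have iter_phi x : iter (2 ^ a) phi x = x.
  have [[nP Hx]|no] := pselect (~ P x /\ h_periodic h N x).
    suff it n : iter n phi x = act (h ^+ (r * n))%g x.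
      by rewrite it -eE; apply: h_periodic_fact Hx.
    elim: n => [|n ih]; first by rewrite muln0 expg0 act1.
    by rewrite iterS ih phiH ?PhX ?HhX// -actD -mulnS.
  have ix : ~ h_periodic h N x \/ P x.
    by have [Px|nP] := pselect (P x); [right|left=> Hx; apply: no].
  rewrite -(prednK a0) expnS mulnC; elim: (2 ^ a.-1)%N => [|n ih]; first by [].
  by rewrite mulSn iterD ih /= inv.
have [g gE] : exists g : IET R, act g =1 phi.
  (* The inverse of [phi] is its iterate of index [2 ^ a - 1]. *)
  have aS : (2 ^ a = (2 ^ a).-1.+1)%N by rewrite prednK// expn_gt0.
  apply: (@act_of _ phi (iter (2 ^ a).-1 phi)) => //.
  - by move=> x; rewrite -iterSr -aS.
  - by move=> x; rewrite -iterS -aS.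
  - move=> x nx; have Px : P x by rewrite /P act_out.
    by rewrite phiP//; have [[m ->] _ _] := hrho x Px; rewrite act_out.
exists g; split; first by apply: act_eq => x; rewrite !actM !gE conj.
exists a; apply: act_eq => x; rewrite act1 -[RHS]iter_phi.
by elim: (2 ^ a)%N => [|n ih]; rewrite ?expg0 ?act1// actS gE ih.
Qed.

End Assembly.

Theorem theorem5 (R : realType) (f : IET R) :
  reversible f ->
  exists h : IET R,
    [/\ reversible_by f h, finite_order h &
        involution h \/ exists n : nat, has_order h n /\ (4 %| n)%N].
Proof.
move=> [h hf]; have hf' : (h * f = f^-1 * h)%g by rewrite -hf mulgVK.
have [g [gf [a ga]]] := reverser_expg2 hf'.
have [fin ord] := order_of_expg2 ga.
by exists g; split=> //; rewrite /reversible_by gf mulgK.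
Qed.
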